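(* If there is an algorithm that enumerates all inclusion-minimal connected dominating sets of split graphs with polynomial delay, then there is an algorithm that enumerates all inclusion-minimal hitting sets of hypergraphs with polynomial delay.
   Context: A connected dominating set of a graph $G=(V,E)$ is a set $S\subseteq V$ such that every vertex outside $S$ has a neighbor in $S$ and $G[S]$ is connected; it is minimal if no proper subset is one. A split graph is a graph whose vertex set can be partitioned into a clique and an independent set. A hypergraph is a pair $(X,\mathcal{S})$ with $\mathcal{S}\subseteq 2^X$; a hitting set is a set $H\subseteq X$ with $H\cap S\neq\emptyset$ for all $S\in\mathcal{S}$, minimal if no proper subset is a hitting set. An enumeration algorithm has polynomial delay if the time before the first output, between consecutive outputs, and after the last output until termination is bounded by a polynomial in the input size, and every solution is output exactly once. *)

(* Defs.v *)
(* A concrete machine model is needed to speak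
   about "algorithms" and "polynomial delay": we use single-tape Turing
   machines with finitely many states and a finite tape alphabet, extended
   with output instructions (append a bit to an output buffer / flush the
   buffer as one output item). *)
From mathcomp Require Import all_boot.
Set Implicit Arguments. Unset Strict Implicit. Unset Printing Implicit Defensive.

(* Tape symbols are 'I_s.+4 : 0 = blank, 1 = bit 0, 2 = bit 1,         *)
(* 3 = separator, further symbols are working symbols.                 *)
(* States are 'I_q.+1, the initial state is 0.                         *)

Inductive dir := DLeft | DRight | DStay.

Inductive action (q s : nat) : Type :=
  | AWrite of 'I_q.+1 & 'I_s.+4 & dir
  | AEmit  of 'I_q.+1 & bool
  | AFlush of 'I_q.+1
  | AHalt.

Record TM := { tm_q : nat; tm_s : nat;
               tm_delta : 'I_tm_q.+1 -> 'I_tm_s.+4 -> action tm_q tm_s }.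

Record config (M : TM) := Config {
  c_state : 'I_(tm_q M).+1;
  c_left  : seq 'I_(tm_s M).+4;   (* cells left of the head, nearest first *)
  c_head  : 'I_(tm_s M).+4;
  c_right : seq 'I_(tm_s M).+4;   (* cells right of the head, nearest first *)
  c_buf   : seq bool }.

Definition tm_step (M : TM) (c : config M) : option (config M * option (seq bool)) :=
  match tm_delta (c_state c) (c_head c) with
  | AWrite q w d =>
      let c' :=
        match d with
        | DStay => Config q (c_left c) w (c_right c) (c_buf c)
        | DLeft => Config q (behead (c_left c)) (head ord0 (c_left c))
                          (w :: c_right c) (c_buf c)
        | DRight => Config q (w :: c_left c) (head ord0 (c_right c))
                           (behead (c_right c)) (c_buf c)
        end in Some (c', None)
  | AEmit q b => Some (Config q (c_left c) (c_head c) (c_right c) (rcons (c_buf c) b), None)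
  | AFlush q => Some (Config q (c_left c) (c_head c) (c_right c) [::], Some (c_buf c))
  | AHalt => None
  end.

Fixpoint tm_run (M : TM) (k : nat) (c : config M) : seq (option (seq bool)) * bool :=
  match k with
  | 0 => ([::], false)
  | k'.+1 =>
      match tm_step c with
      | None => ([::], true)
      | Some (c', e) => let r := tm_run k' c' in (e :: r.1, r.2)
      end
  end.

(* Initial configuration on input word x (symbols given as naturals < 4). *)
Definition tm_init (M : TM) (x : seq nat) : config M :=
  let w := [seq (inord k : 'I_(tm_s M).+4) | k <- x] in
  Config ord0 [::] (head ord0 w) (behead w) [::].

(* Time stamps: 0, the times of the outputs, and the halting time. *)
Definition marks (es : seq (option (seq bool))) : seq nat :=
  0 :: [seq i.+1 | i <- iota 0 (size es) & nth None es i] ++ [:: size es].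

Definition delays_bounded (b : nat) (es : seq (option (seq bool))) : bool :=
  let m := marks es in all (fun p => p.2 - p.1 <= b) (zip m (behead m)).

Definition poly_delay_enum (M : TM) (I : Type) (valid : I -> Prop)
    (enc : I -> seq nat) (sol : I -> seq bool -> Prop) : Prop :=
  exists c d : nat, forall x : I, valid x ->
    exists k : nat,
      let r := tm_run k (tm_init M (enc x)) in
      let outs := pmap id r.1 in
      [/\ r.2,
          delays_bounded (c * (size (enc x)).+1 ^ d) r.1,
          uniq outs &
          forall s, s \in outs <-> sol x s].

Definition charvec (n : nat) (S : {set 'I_n}) : seq bool := [seq i \in S | i <- enum 'I_n].
Definition bitsym (b : bool) : nat := if b then 2 else 1.

Record graph := Graph { g_n : nat; g_adj : rel 'I_g_n }.

Definition simple_graph (G : graph) : Prop :=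
  symmetric (@g_adj G) /\ irreflexive (@g_adj G).

Definition is_clique (G : graph) (K : {set 'I_(g_n G)}) : Prop :=
  forall u v, u \in K -> v \in K -> u != v -> @g_adj G u v.
Definition is_independent (G : graph) (I : {set 'I_(g_n G)}) : Prop :=
  forall u v, u \in I -> v \in I -> ~~ @g_adj G u v.

Definition split_graph (G : graph) : Prop :=
  simple_graph G /\
  exists K I : {set 'I_(g_n G)},
    [/\ K :|: I = setT, K :&: I = set0, is_clique K & is_independent I].

Definition dominating (G : graph) (S : {set 'I_(g_n G)}) : Prop :=
  forall v, v \notin S -> exists2 u, u \in S & @g_adj G v u.

Definition induced_connected (G : graph) (S : {set 'I_(g_n G)}) : Prop :=
  forall u v, u \in S -> v \in S ->
    connect (fun x y => [&& x \in S, y \in S & @g_adj G x y]) u v.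

Definition cds (G : graph) (S : {set 'I_(g_n G)}) : Prop :=
  dominating S /\ induced_connected S.

Definition minimal_cds (G : graph) (S : {set 'I_(g_n G)}) : Prop :=
  cds S /\ forall T : {set 'I_(g_n G)}, T \proper S -> ~ cds T.

Definition enc_graph (G : graph) : seq nat :=
  flatten [seq rcons [seq bitsym (@g_adj G i j) | j <- enum 'I_(g_n G)] 3
          | i <- enum 'I_(g_n G)].

Definition cds_sol (G : graph) (s : seq bool) : Prop :=
  exists S : {set 'I_(g_n G)}, minimal_cds S /\ s = charvec S.

(* Hypergraph on ground set 'I_n; the family of edges given as a
   duplicate-free list (in arbitrary order). *)
Record hypergraph := Hypergraph { h_n : nat; h_edges : seq {set 'I_h_n} }.

Definition hyp_valid (H : hypergraph) : Prop := uniq (h_edges H).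

Definition hitting (H : hypergraph) (X : {set 'I_(h_n H)}) : Prop :=
  forall E, E \in h_edges H -> X :&: E != set0.

Definition minimal_hitting (H : hypergraph) (X : {set 'I_(h_n H)}) : Prop :=
  hitting X /\ forall T : {set 'I_(h_n H)}, T \proper X -> ~ hitting T.

Definition enc_hyp (H : hypergraph) : seq nat :=
  rcons (nseq (h_n H) 2) 3 ++
  flatten [seq rcons [seq bitsym (i \in E) | i <- enum 'I_(h_n H)] 3 | E : {set 'I_(h_n H)} <- h_edges H].

Definition mhs_sol (H : hypergraph) (s : seq bool) : Prop :=
  exists X : {set 'I_(h_n H)}, minimal_hitting X /\ s = charvec X.

(* Main.v *)
From HB Require Import structures.
Require Import Defs.
From mathcomp Require Import all_boot zify.
Set Implicit Arguments. Unset Strict Implicit. Unset Printing Implicit Defensive.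

(** Given a hypergraph, take a clique on its elements x_i and a hub z, attach
    pendant vertices (at least two) to z, and join an independent vertex per edge
    to the elements of that edge. The pendants force z into every connected
    dominating set, and connectivity forces a neighbour of each edge vertex into
    it, so the minimal connected dominating sets are the sets {z} ∪ T with T a
    minimal hitting set.

    The head of the enumerating machine may be exponentially far from its start
    when it prints a bit, so T has to be read off its output with finite memory.
    A pendant is therefore placed before each x_i and z after all of them: then a
    control bit 0 announces a bit of T, and the first control bit 1 ends T.

    The encoded graph is computed from the encoded hypergraph by a program over
    a few queues. All queues live interleaved on the tape as tagged letters: a
    push appends at the right end and a pop overwrites the first letter of the
    queue by a tombstone. What remains of this phase is erased before the given
    machine is started, and from then on every step of it takes one step. *)

(** * The split graph of a hypergraph *)

Inductive kind := Pend | Elt of nat | Hub | Edg of seq bool.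

Definition kadj (a b : kind) : bool :=
  match a, b with
  | Pend, Hub | Hub, Pend | Elt _, Hub | Hub, Elt _ => true
  | Elt i, Elt j => i != j
  | Elt i, Edg r | Edg r, Elt i => nth false r i
  | _, _ => false
  end.

(** The two pendants behind the hub guarantee at least two even when [n = 0]. *)
Definition kinds (n : nat) (rows : seq (seq bool)) : seq kind :=
  flatten [seq [:: Pend; Elt k] | k <- iota 0 n] ++ [:: Hub; Pend; Pend]
  ++ map Edg rows.

Definition kmem (t : seq bool) (a : kind) : bool :=
  match a with Hub => true | Elt i => nth false t i | _ => false end.

Definition split_of (n : nat) (rows : seq (seq bool)) : graph :=
  @Graph (size (kinds n rows))
    (fun u v => kadj (nth Pend (kinds n rows) u) (nth Pend (kinds n rows) v)).

Lemma kadjC a b : kadj a b = kadj b a.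
Proof. by case: a => [|i||r]; case: b => [|j||r'] //=; rewrite eq_sym. Qed.

Lemma kadjxx a : kadj a a = false.
Proof. by case: a => //= i; rewrite eqxx. Qed.

Lemma map_enum_nth (A B : Type) (x0 : A) (f : A -> B) (s : seq A) :
  [seq f (nth x0 s i) | i : 'I_(size s) <- enum 'I_(size s)] = map f s.
Proof.
by rewrite -[in RHS](mkseq_nth x0 s) /mkseq -val_enum_ord -!map_comp.
Qed.

Lemma enc_split_of n rows : enc_graph (split_of n rows) =
  flatten [seq rcons [seq bitsym (kadj a b) | b <- kinds n rows] 3 | a <- kinds n rows].
Proof.
rewrite /enc_graph; congr flatten.
rewrite -[RHS](map_enum_nth Pend (fun a => rcons [seq bitsym (kadj a b) | b <- kinds n rows] 3)).
apply: eq_map => i /=; congr rcons.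
by rewrite -(map_enum_nth Pend (fun b => bitsym (kadj _ b))).
Qed.

(** * Positions and kinds of the vertices *)

Section Vertices.
Variables (n : nat) (rows : seq (seq bool)).
Let ks := kinds n rows.
Let V := 'I_(size ks).
Let kd (u : V) : kind := nth Pend ks u.

Lemma size_pairs a k :
  size (flatten [seq [:: Pend; Elt j] | j <- iota a k]) = k.*2.
Proof. by elim: k a => //= k IHk a; rewrite IHk doubleS. Qed.

Lemma size_kinds : size ks = n.*2 + 3 + size rows.
Proof. by rewrite /ks /kinds !size_cat size_pairs size_map /= addnA. Qed.

Lemma nth_pairs a k i : i < k.*2 ->
  nth Pend (flatten [seq [:: Pend; Elt j] | j <- iota a k]) i
  = if odd i then Elt (a + i./2) else Pend.
Proof.
elim: k a i => // k IHk a [|[|i]] //=; first by rewrite addn0.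
by rewrite doubleS !ltnS => /IHk ->; rewrite negbK addSnnS.
Qed.

Lemma nth_kinds u : nth Pend ks u =
  if u < n.*2 then (if odd u then Elt u./2 else Pend)
  else nth Pend ([:: Hub; Pend; Pend] ++ map Edg rows) (u - n.*2).
Proof.
by rewrite /ks /kinds nth_cat size_pairs; case: ltnP => // /(@nth_pairs 0) ->.
Qed.

Lemma elt_subproof i : i < n -> i.*2.+1 < size ks.
Proof. by rewrite size_kinds; lia. Qed.

Lemma hub_subproof : n.*2 < size ks. Proof. by rewrite size_kinds; lia. Qed.
Lemma pend1_subproof : n.*2.+1 < size ks. Proof. by rewrite size_kinds; lia. Qed.
Lemma pend2_subproof : n.*2.+2 < size ks. Proof. by rewrite size_kinds; lia. Qed.
Let hub : V := Ordinal hub_subproof.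
Let pend1 : V := Ordinal pend1_subproof.
Let pend2 : V := Ordinal pend2_subproof.
Let elt (i : 'I_n) : V := Ordinal (elt_subproof (ltn_ord i)).

Lemma kd_elt i : kd (elt i) = Elt i.
Proof.
rewrite /kd nth_kinds /= ifT; last by have := ltn_ord i; lia.
by rewrite odd_double /= uphalf_double.
Qed.

Lemma kd_hub : kd hub = Hub.
Proof. by rewrite /kd nth_kinds /= ltnn subnn. Qed.

Lemma kd_pend1 : kd pend1 = Pend.
Proof. by rewrite /kd nth_kinds /= ltnNge leqnSn /= subSnn. Qed.

Lemma kd_pend2 : kd pend2 = Pend.
Proof.
rewrite /kd nth_kinds /=.
have -> : (n.*2.+2 < n.*2) = false by lia.
by have -> : n.*2.+2 - n.*2 = 2 by lia.
Qed.

(** An element or the hub is the only vertex of its kind, so distinct clique vertices have distinct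
    kinds. Pendants repeat, and so may edge kinds, hence no position is recorded for them. *)
Variant kd_spec (u : V) : kind -> Prop :=
  | KdElt i of u = elt i : kd_spec u (Elt i)
  | KdHub of u = hub : kd_spec u Hub
  | KdPend : kd_spec u Pend
  | KdEdg r of r \in rows : kd_spec u (Edg r).

Lemma kdP u : kd_spec u (kd u).
Proof.
rewrite /kd nth_kinds; case: ltnP => hu.
  case: ifP => ou; last exact: KdPend.
  have lt_un : u./2 < n by lia.
  apply: (@KdElt _ (Ordinal lt_un)); apply: val_inj => /=.
  by rewrite -[LHS]odd_double_half ou.
have hs : u < n.*2 + 3 + size rows by rewrite -size_kinds.
case e : (u - n.*2) => [|[|[|j]]] /=; try exact: KdPend.
  by apply: KdHub; apply: val_inj => /=; lia.
have lt_j : j < size rows by lia.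
by rewrite (nth_map [::]) //; apply/KdEdg/mem_nth.
Qed.

Lemma edge_vertex r : r \in rows -> exists u, kd u = Edg r.
Proof.
move=> /(nthP [::]) [j lt_j <-].
have hj : n.*2 + 3 + j < size ks by rewrite size_kinds ltn_add2l.
exists (Ordinal hj); rewrite /kd nth_kinds /= ifF; last by lia.
have -> : n.*2 + 3 + j - n.*2 = j.+3 by lia.
by rewrite /= (nth_map [::]).
Qed.

End Vertices.

(** * Minimal connected dominating sets versus minimal hitting sets *)

Section Reduction.
Variable H : hypergraph.
Let n := h_n H.
Let rows := [seq charvec E | E <- h_edges H].
Let ks := kinds n rows.
Let G := split_of n rows.
Let V := 'I_(size ks).
Let kd (u : V) : kind := nth Pend ks u.
Let hub : V := Ordinal (hub_subproof n rows).
Let elt (i : 'I_n) : V := Ordinal (elt_subproof rows (ltn_ord i)).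

Let adjE (u v : V) : @g_adj G u v = kadj (kd u) (kd v).
Proof. by []. Qed.

Let kindP (u : V) : kd_spec u (kd u) := kdP u.
Let kd_eltE i : kd (elt i) = Elt i := kd_elt rows i.
Let kd_hubE : kd hub = Hub := kd_hub n rows.

Lemma nth_charvec (m : nat) (S : {set 'I_m}) (i : 'I_m) :
  nth false (charvec S) i = (i \in S).
Proof. by rewrite /charvec (nth_map i) ?nth_ord_enum // size_enum_ord. Qed.

Lemma size_charvec (m : nat) (S : {set 'I_m}) : size (charvec S) = m.
Proof. by rewrite size_map size_enum_ord. Qed.

Lemma split_of_split : split_graph G.
Proof.
split; first by split=> [u v | u]; [apply: kadjC | apply: kadjxx].
pose cl (u : V) := match kd u with Elt _ | Hub => true | _ => false end.
exists [set u | cl u], [set u | ~~ cl u]; split.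
- by apply/setP=> u; rewrite !inE orbN.
- by apply/setP=> u; rewrite !inE andbN.
- suff key (u v : V) : cl u -> cl v -> u != v -> kadj (kd u) (kd v).
    by move=> u v; rewrite !inE; apply: key.
  rewrite /cl.
  case: (kindP u) => [i -> | -> | | r _] //; case: (kindP v) => [j -> | -> | | r' _] // _ _ //=.
  + by move=> neq; apply: contraNneq neq => eij; apply/eqP/val_inj; rewrite /= eij.
  + by rewrite eqxx.
- suff key (u v : V) : ~~ cl u -> ~~ cl v -> ~~ kadj (kd u) (kd v).
    by move=> u v; rewrite !inE; apply: key.
  rewrite /cl.
  by case: (kindP u) => [i _ | _ | | r _] //; case: (kindP v).
Qed.

Definition embed (T : {set 'I_n}) : {set V} := [set u | kmem (charvec T) (kd u)].
Definition trace (S : {set V}) : {set 'I_n} := [set i | elt i \in S].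

Lemma charvec_embed T : charvec (embed T) = map (kmem (charvec T)) ks.
Proof.
rewrite -(map_enum_nth Pend); apply: eq_map => u; by rewrite inE.
Qed.

Lemma elt_embed T i : (elt i \in embed T) = (i \in T).
Proof. by rewrite inE kd_eltE /= nth_charvec. Qed.

Lemma hub_embed T : hub \in embed T.
Proof. by rewrite inE kd_hubE. Qed.

Lemma connect_neighbor (S : {set V}) (u v : V) : u != v ->
  connect (fun x y => [&& x \in S, y \in S & kadj (kd x) (kd y)]) u v ->
  exists2 w, w \in S & kadj (kd u) (kd w).
Proof.
move=> neq_uv /connectP [[|w p] /= pth eqv]; first by rewrite eqv eqxx in neq_uv.
by have /andP [/and3P [_ wS uw] _] := pth; exists w.
Qed.

(** The hub is the only neighbour of a pendant. Without it, domination would put both [p1] and [p2]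
    into [S], and a path between them would have to begin with the hub. *)
Lemma cds_hub S : @cds G S -> hub \in S.
Proof.
move=> [domS conS]; apply/negPn/negP => hubS.
pose p1 : V := Ordinal (pend1_subproof n rows).
pose p2 : V := Ordinal (pend2_subproof n rows).
have nbr (p : V) w : kd p = Pend -> kadj (kd p) (kd w) -> w \in S -> False.
  by move=> ->; case: (kindP w) => // -> _; apply/negP.
have inS p : kd p = Pend -> p \in S.
  move=> kp; apply/negPn/negP => /domS [w wS pw].
  exact: nbr kp pw wS.
have neq : p1 != p2 by apply/eqP => /(congr1 val) /=; lia.
have [w wS pw] := connect_neighbor neq
  (conS p1 p2 (inS _ (kd_pend1 n rows)) (inS _ (kd_pend2 n rows))).
exact: nbr (kd_pend1 n rows) pw wS.
Qed.

(** The vertex of an edge has a neighbour in [S]: by domination if it is outside [S], and otherwise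
    by the first step of a path to the hub. Its neighbours are exactly the elements of the edge. *)
Lemma trace_hitting S : @cds G S -> hitting (trace S).
Proof.
move=> cdsS E EH; have hubS := cds_hub cdsS; have [domS conS] := cdsS.
have [e ke] : exists u : V, kd u = Edg (charvec E).
  by apply: edge_vertex; apply: map_f.
have [w wS ew] : exists2 w, w \in S & kadj (kd e) (kd w).
  have [eS|] := boolP (e \in S); last by move/domS.
  apply: (connect_neighbor _ (conS e hub eS hubS)).
  by apply/eqP => eh; rewrite eh kd_hubE in ke.
move: ew; rewrite ke; case: (kindP w) => // i ew /=; rewrite nth_charvec => iE.
by apply/set0Pn; exists i; rewrite !inE iE andbT; move: wS; rewrite ew.
Qed.

(** [embed T] is a clique, so it is connected by single edges. Its hub dominates pendants and
    elements, and an element of [T] in an edge dominates the vertex of that edge. *)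
Lemma embed_cds T : hitting T -> @cds G (embed T).
Proof.
move=> hitT; split=> [v | u v].
  suff: v \notin embed T -> exists2 u, u \in embed T & kadj (kd v) (kd u) by [].
  rewrite inE; case: (kindP v) => [i _ _ | // | _ | r] /=.
  - by exists hub; rewrite ?hub_embed // kd_hubE.
  - by exists hub; rewrite ?hub_embed // kd_hubE.
  - move=> /mapP [E EH ->] _; have /set0Pn [i] := hitT E EH.
    rewrite inE => /andP [iT iE]; exists (elt i); first by rewrite elt_embed.
    by rewrite kd_eltE nth_charvec.
move=> uT vT; have [-> | neq_uv] := eqVneq u v; first exact: connect0.
apply: connect1; rewrite uT vT adjE /=.
suff key (x y : V) : x \in embed T -> y \in embed T -> x != y -> kadj (kd x) (kd y).
  exact: key.
rewrite !inE; case: (kindP x) => [i -> | -> | | r _] //= _.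
  case: (kindP y) => [j -> | -> | | r' _] //= _.
  by move=> neq; apply: contraNneq neq => eij; apply/eqP/val_inj; rewrite /= eij.
by case: (kindP y) => [j -> | -> | | r' _] //= _; rewrite eqxx.
Qed.

Lemma embed_sub S : @cds G S -> embed (trace S) \subset S.
Proof.
move=> cdsS; apply/subsetP => u; rewrite inE.
case: (kindP u) => [i -> | -> _ | | r _] //=; last exact: cds_hub.
by rewrite nth_charvec inE.
Qed.

Lemma embed_proper (T' T : {set 'I_n}) : T' \proper T -> embed T' \proper embed T.
Proof.
move=> /properP [/subsetP sub [i iT niT']]; apply/properP; split.
  apply/subsetP => u; rewrite !inE; case: (kindP u) => //= j _.
  by rewrite !nth_charvec; apply: sub.
by exists (elt i); rewrite elt_embed.
Qed.

(** Any connected dominating set contains the connected dominating set [embed (trace S)], so a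
    minimal one equals it. Conversely, a smaller one inside [embed T] has its trace in [T]; equality
    of the two would give [embed T] back inside it, and a proper trace contradicts minimality of
    [T]. *)
Lemma minimal_cdsP S :
  @minimal_cds G S <-> exists2 T, minimal_hitting T & S = embed T.
Proof.
split=> [[cdsS minS] | [T [hitT minT] ->]].
  have hitS := trace_hitting cdsS.
  have defS : S = embed (trace S).
    apply/eqP; rewrite eqEsubset andbC embed_sub //=; apply/negPn/negP => nsub.
    apply: (minS (embed (trace S))); last exact: embed_cds.
    by rewrite properE embed_sub.
  exists (trace S) => //; split=> // T prT hitT.
  apply: (minS (embed T)); last exact: embed_cds.
  by have := embed_proper prT; rewrite -defS.
split=> [|S' prS cdsS]; first exact: embed_cds.
apply: (minT (trace S')); last exact: trace_hitting.
have sub : trace S' \subset T.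
  apply/subsetP => i; rewrite inE => iS; rewrite -elt_embed.
  exact: (subsetP (proper_sub prS)).
rewrite properEneq sub andbT; apply/eqP => eqT.
by move: prS; rewrite -eqT properE embed_sub // andbF.
Qed.

End Reduction.

(* The vertex order of [kinds] makes the forced bits of a solution drive the
   filter: a pendant (never in a minimal solution) announces that the next bit
   is data, and the hub (always in) announces that the rest is to be skipped.
   The mode [None] awaits such a control bit, [Some true] a data bit, and
   [Some false] skips. *)
Definition filter_step (st : option bool * seq bool) (b : bool) :=
  match st.1 with
  | None => (Some (~~ b), st.2)
  | Some true => (None, rcons st.2 b)
  | Some false => (Some false, st.2)
  end.

Definition filter_run (s : seq bool) := foldl filter_step (None, [::]) s.
Definition filter_out (s : seq bool) : seq bool := (filter_run s).2.

Lemma filter_out_kinds n rows t : size t = n ->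
  filter_out (map (kmem t) (kinds n rows)) = t.
Proof.
move=> <-; rewrite /filter_out /filter_run /kinds !map_cat foldl_cat.
have dead s o : foldl filter_step (Some false, o) s = (Some false, o).
  by elim: s.
suff -> : foldl filter_step (None, [::])
    (map (kmem t) (flatten [seq [:: Pend; Elt k] | k <- iota 0 (size t)])) = (None, t).
  by rewrite /= /filter_step /= dead.
(* The induction is on the suffix [u] of [t] that is still to be read, while [o] is the part already
   collected. *)
suff gen a o u : drop a t = u -> foldl filter_step (None, o)
    (map (kmem t) (flatten [seq [:: Pend; Elt k] | k <- iota a (size u)])) = (None, o ++ u).
  by rewrite (gen 0 [::] t) // drop0.
elim: u a o => [|x u IHu] a o def_u /=; first by rewrite cats0.
have lt_a : a < size t.
  by rewrite ltnNge; apply/negP => /drop_oversize e; rewrite e in def_u.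
move: def_u; rewrite (drop_nth false) // => -[ex eu].
by rewrite /filter_step /= -/filter_step IHu // ex cat_rcons.
Qed.

Lemma cds_sol_split_of H s :
  cds_sol (split_of (h_n H) [seq charvec E | E <- h_edges H]) s <->
  exists2 t, mhs_sol H t &
    s = map (kmem t) (kinds (h_n H) [seq charvec E | E <- h_edges H]).
Proof.
split=> [[S [/minimal_cdsP [T minT ->] ->]] | [t [T [minT ->]] ->]].
  by exists (charvec T); [exists T | rewrite charvec_embed].
exists (embed T); split; last by rewrite charvec_embed.
by apply/minimal_cdsP; exists T.
Qed.

(** * Queue programs *)

Inductive qname := QI | QN | QE | QF | QP | QO.

Definition qname_code (i : qname) : nat :=
  match i with QI => 0 | QN => 1 | QE => 2 | QF => 3 | QP => 4 | QO => 5 end.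
Definition qname_decode (k : nat) : option qname :=
  nth None (map Some [:: QI; QN; QE; QF; QP; QO]) k.
Lemma qname_codeK : pcancel qname_code qname_decode. Proof. by case. Qed.
HB.instance Definition _ := Countable.copy qname (pcan_type qname_codeK).
Lemma qname_enumP : Finite.axiom [:: QI; QN; QE; QF; QP; QO]. Proof. by case. Qed.
HB.instance Definition _ := isFinite.Build qname qname_enumP.

(* [None] is an end-of-queue marker, [Some None] the separator. *)
Definition letter := option (option bool).

Record store := Store { s_I : seq letter; s_N : seq letter; s_E : seq letter;
                        s_F : seq letter; s_P : seq letter; s_O : seq letter }.

Definition sget (st : store) (i : qname) : seq letter :=
  match i with
  | QI => s_I st | QN => s_N st | QE => s_E st
  | QF => s_F st | QP => s_P st | QO => s_O st
  end.

Definition sset (st : store) (i : qname) (w : seq letter) : store :=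
  let: Store a b c d e f := st in
  match i with
  | QI => Store w b c d e f | QN => Store a w c d e f | QE => Store a b w d e f
  | QF => Store a b c w e f | QP => Store a b c d w f | QO => Store a b c d e w
  end.

Lemma sget_sset st i w j : sget (sset st i w) j = if j == i then w else sget st j.
Proof. by case: st i j => a b c d e f [] []. Qed.

Definition spush st i x := sset st i (sget st i ++ [:: x]).
Definition spop st i := sset st i (behead (sget st i)).

(* [For i sx body] pops letters off queue [i] and runs [body] on each; it stops
   (consuming the letter) on the end marker, on the empty queue, and on a
   separator when [sx] holds. *)
Inductive cmd :=
  | Push of qname & letter
  | Seq of cmd & cmd
  | For of qname & bool & (option bool -> cmd).

Definition exits (sx : bool) (x : option letter) : bool :=
  match x with Some (Some (Some _)) => false | Some (Some None) => sx | _ => true end.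

(* The cost is an upper bound on the number of pushes and pops. *)
Inductive exec : cmd -> store -> nat -> store -> Prop :=
  | EPush i x st : exec (Push i x) st 1 (spush st i x)
  | ESeq c1 c2 st n1 st1 n2 st2 : exec c1 st n1 st1 -> exec c2 st1 n2 st2 ->
      exec (Seq c1 c2) st (n1 + n2) st2
  | EForExit i sx body st : exits sx (ohead (sget st i)) ->
      exec (For i sx body) st 1 (spop st i)
  | EForStep i sx body st x n1 st1 n2 st2 :
      ohead (sget st i) = Some (Some x) -> ~~ exits sx (Some (Some x)) ->
      exec (body x) (spop st i) n1 st1 -> exec (For i sx body) st1 n2 st2 ->
      exec (For i sx body) st (n1 + n2).+1 st2
  | ELe c st n m st' : exec c st n st' -> n <= m -> exec c st m st'.

(** A syntactic condition under which a run preserves the tape shape [tidy]. *)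
Fixpoint out_only (c : cmd) : Prop :=
  match c with
  | Push i _ => i = QI
  | Seq c1 c2 => out_only c1 /\ out_only c2
  | For i _ body => i <> QI /\ forall x, out_only (body x)
  end.

(** * Compilation of queue programs to code with explicit jumps *)

Inductive instr :=
  | IPush of qname & letter & nat
  | IPop of qname & (option letter -> nat)
  | IHalt.

Fixpoint len (c : cmd) : nat :=
  match c with
  | Push _ _ => 1
  | Seq c1 c2 => len c1 + len c2
  | For _ _ body => (len (body None) + len (body (Some false)) + len (body (Some true))).+1
  end.

Definition for_label (sx : bool) (body : option bool -> cmd) (k ex : nat)
    (x : option letter) : nat :=
  if exits sx x then ex else
  match x with
  | Some (Some None) => k.+1
  | Some (Some (Some false)) => k.+1 + len (body None)
  | _ => k.+1 + len (body None) + len (body (Some false))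
  end.

(** The code occupies the addresses from [k] on and leaves through [ex]. A loop is a pop followed by
    one copy of the body per possible letter, each of which jumps back to the pop at [k]. *)
Fixpoint compile (c : cmd) (k ex : nat) : seq instr :=
  match c with
  | Push i x => [:: IPush i x ex]
  | Seq c1 c2 => compile c1 k (k + len c1) ++ compile c2 (k + len c1) ex
  | For i sx body =>
      IPop i (for_label sx body k ex) ::
      compile (body None) k.+1 k ++
      compile (body (Some false)) (k.+1 + len (body None)) k ++
      compile (body (Some true)) (k.+1 + len (body None) + len (body (Some false))) k
  end.

Lemma size_compile c k ex : size (compile c k ex) = len c.
Proof.
elim: c k ex => [//|c1 IH1 c2 IH2|i sx body IH] k ex /=; first by rewrite size_cat IH1 IH2.
by rewrite !size_cat !IH addnA.
Qed.

Lemma len_gt0 c : 0 < len c.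
Proof. by elim: c => //= c1 IH1 c2 _; rewrite ltn_addr. Qed.

(** The exit may be [size prog], one past the end, where [nth] yields its default [IHalt]. *)
Definition placed (prog : seq instr) (c : cmd) (k ex : nat) : Prop :=
  ex <= size prog /\
  exists pre post, prog = pre ++ compile c k ex ++ post /\ size pre = k.

Lemma placed_lt prog c k ex : placed prog c k ex -> k < size prog.
Proof.
case=> _ [pre [post [-> <-]]]; rewrite !size_cat size_compile.
by have := len_gt0 c; lia.
Qed.

Lemma placed_seq prog c1 c2 k ex : placed prog (Seq c1 c2) k ex ->
  placed prog c1 k (k + len c1) /\ placed prog c2 (k + len c1) ex.
Proof.
move=> pl; have [le_ex [pre [post [eqp szp]]]] := pl.
have pl2 : placed prog c2 (k + len c1) ex.
  split=> //; exists (pre ++ compile c1 k (k + len c1)), post.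
  by rewrite size_cat size_compile szp eqp /= !catA.
split=> //; split; first exact: ltnW (placed_lt pl2).
by exists pre, (compile c2 (k + len c1) ex ++ post); rewrite eqp /= !catA.
Qed.

Lemma placed_for prog i sx body k ex : placed prog (For i sx body) k ex ->
  nth IHalt prog k = IPop i (for_label sx body k ex) /\
  forall x, ~~ exits sx (Some (Some x)) ->
    placed prog (body x) (for_label sx body k ex (Some (Some x))) k.
Proof.
move=> pl; have lt_k := placed_lt pl; have [le_ex [pre [post [eqp szp]]]] := pl.
split; first by rewrite eqp nth_cat szp ltnn subnn.
move=> x nx; split; first exact: ltnW.
rewrite /for_label (negbTE nx); move: eqp => /=; set i0 := IPop _ _.
set c0 := compile (body None) _ _; set c1 := compile (body (Some false)) _ _.
set c2 := compile (body (Some true)) _ _ => eqp.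
have sz0 : size c0 = len (body None) by rewrite size_compile.
have sz1 : size c1 = len (body (Some false)) by rewrite size_compile.
case: x {nx} => [[]|].
- exists (pre ++ i0 :: c0 ++ c1), post; rewrite eqp !size_cat /= size_cat sz0 sz1 szp.
  by rewrite -!catA /= -!catA; split=> //; lia.
- exists (pre ++ i0 :: c0), (c2 ++ post); rewrite eqp !size_cat /= sz0 szp.
  by rewrite -!catA; split=> //; lia.
- exists (pre ++ [:: i0]), (c1 ++ c2 ++ post); rewrite eqp !size_cat /= szp.
  by rewrite -!catA; split=> //; lia.
Qed.

Lemma placed_push prog i x k ex : placed prog (Push i x) k ex ->
  nth IHalt prog k = IPush i x ex.
Proof. by case=> _ [pre [post [-> <-]]]; rewrite nth_cat ltnn subnn. Qed.

(** * The combined machine *)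

Section Machine.
Variables (M : TM) (prog : seq instr).

(** Symbols are those of [M], the tagged queue letters, and [inr None] as tombstone. States are a
    program counter with a direction of travel, [inr None] for the erasing phase, and a state of [M]
    paired with a filter mode. *)
Definition sym : Type := 'I_(tm_s M).+4 + option (qname * letter).
Definition state : Type :=
  ('I_(size prog).+1 * bool) + option ('I_(tm_q M).+1 * option bool).

Definition blank : sym := inl ord0.
Definition tomb : sym := inr None.

Definition plain_letter (k : nat) : option (qname * letter) :=
  match k with
  | 1 => Some (QI, Some (Some false))
  | 2 => Some (QI, Some (Some true))
  | 3 => Some (QI, Some None)
  | _ => None
  end.

Definition plain_code (x : option bool) : nat :=
  if x is Some b then bitsym b else 3.

Definition view (a : sym) : option (qname * letter) :=
  match a with inl k => plain_letter k | inr x => x end.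

(* Queue [QI] uses the input alphabet, so that it initially holds the input word
   and finally the word handed over to [M]. *)
Definition write (i : qname) (x : letter) : sym :=
  match i, x with
  | QI, Some y => inl (inord (plain_code y))
  | _, _ => inr (Some (i, x))
  end.

Inductive act :=
  | Move of state & sym & dir
  | Emit of state & bool
  | Flush of state
  | Halt.

Definition goto (l : nat) (fwd : bool) : state := inl (inord l, fwd).

(** Each queue instruction is one round trip: the head walks right to the first letter of the queue
    or to the blank behind the content, acts there, and walks left until it meets a blank. A bit
    that the filter drops becomes a step that stays in place, so the simulation of [M] keeps its
    pace. *)
Definition delta (p : state) (a : sym) : act :=
  match p with
  | inl (pc, true) =>
      match nth IHalt prog pc with
      | IPush i x l =>
          if a == blank then Move (goto l false) (write i x) DLeft
          else Move p a DRight
      | IPop i tbl =>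
          if a == blank then Move (goto (tbl None) false) blank DLeft
          else match view a with
               | Some (j, x) =>
                   if j == i then Move (goto (tbl (Some x)) false) tomb DLeft
                   else Move p a DRight
               | None => Move p a DRight
               end
      | IHalt => Move (inr None) a DStay
      end
  | inl (pc, false) =>
      if a == blank then Move (inl (pc, true)) blank DRight else Move p a DLeft
  | inr None =>
      if view a is Some (QI, _) then Move (inr (Some (ord0, None))) a DStay
      else Move p blank DRight
  | inr (Some (r, mode)) =>
      match a with
      | inl k =>
          match tm_delta r k with
          | AWrite r' w d => Move (inr (Some (r', mode))) (inl w) d
          | AEmit r' b =>
              match mode with
              | None => Move (inr (Some (r', Some (~~ b)))) a DStay
              | Some true => Emit (inr (Some (r', None))) b
              | Some false => Move (inr (Some (r', Some false))) a DStay
              end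
          | AFlush r' => Flush (inr (Some (r', None)))
          | AHalt => Halt
          end
      | inr _ => Halt
      end
  end.

(** * Numbering of states and symbols; runs on decoded configurations *)

Definition start : state := inl (ord0, true).

(** The initial state of a machine has number 0, so [start] gets that number and all other states
    are shifted past it. *)
Definition enc_state (p : state) : 'I_#|{: state}|.+1 :=
  if p == start then ord0 else lift ord0 (enum_rank p).
Definition dec_state (i : 'I_#|{: state}|.+1) : state :=
  if unlift ord0 i is Some j then enum_val j else start.

Lemma enc_stateK : cancel enc_state dec_state.
Proof.
move=> p; rewrite /enc_state /dec_state; case: eqP => [->|_].
  by rewrite unlift_none.
by rewrite liftK enum_rankK.
Qed.

Definition nsym : nat := tm_s M + #|{: option (qname * letter)}|.

(** The symbols of [M] keep their numbers, so that blank and the input symbols mean the same to both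
    machines. *)
Definition enc_sym (a : sym) : 'I_nsym.+4 :=
  match a with
  | inl k => @lshift (tm_s M).+4 _ k
  | inr x => @rshift (tm_s M).+4 _ (enum_rank x)
  end.
Definition dec_sym (i : 'I_nsym.+4) : sym :=
  match @split (tm_s M).+4 _ i with inl k => inl k | inr j => inr (enum_val j) end.

Lemma enc_symK : cancel enc_sym dec_sym.
Proof.
case=> [k|x]; rewrite /enc_sym /dec_sym.
  by rewrite -/(unsplit (inl _ k)) unsplitK.
by rewrite -/(unsplit (inr _ (enum_rank x))) unsplitK enum_rankK.
Qed.

Lemma enc_blank : enc_sym blank = ord0.
Proof. exact: val_inj. Qed.

Definition machine : TM :=
  @Build_TM #|{: state}| nsym (fun i j =>
    match delta (dec_state i) (dec_sym j) with
    | Move p a d => AWrite (enc_state p) (enc_sym a) d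
    | Emit p b => AEmit _ (enc_state p) b
    | Flush p => AFlush _ (enc_state p)
    | Halt => AHalt _ _
    end).

(** The head cell is the first entry of [w], or blank if [w] is empty. *)
Definition mk (p : state) (l w : seq sym) (b : seq bool) : config machine :=
  @Config machine (enc_state p) (map enc_sym l) (enc_sym (head blank w))
    (map enc_sym (behead w)) b.

Lemma head_map_sym w : head ord0 (map enc_sym w) = enc_sym (head blank w).
Proof. by case: w => //; apply: esym enc_blank. Qed.

Lemma step_mk p l a w b : tm_step (mk p l (a :: w) b) =
  match delta p a with
  | Move p' x d => Some (match d with
      | DStay => mk p' l (x :: w) b
      | DLeft => mk p' (behead l) (head blank l :: x :: w) b
      | DRight => mk p' (x :: l) w b
      end, None)
  | Emit p' x => Some (mk p' l (a :: w) (rcons b x), None)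
  | Flush p' => Some (mk p' l (a :: w) [::], Some b)
  | Halt => None
  end.
Proof.
rewrite /tm_step /= enc_stateK enc_symK.
case: (delta p a) => // p' x d; rewrite /mk !head_map_sym -!behead_map.
by case: d.
Qed.

Inductive silent : nat -> config machine -> config machine -> Prop :=
  | Silent0 c : silent 0 c c
  | SilentS n c c1 c2 : tm_step c = Some (c1, None) -> silent n c1 c2 ->
      silent n.+1 c c2.

Lemma silent_trans n1 n2 c1 c2 c3 :
  silent n1 c1 c2 -> silent n2 c2 c3 -> silent (n1 + n2) c1 c3.
Proof.
elim=> [//|n c c' c'' st _ IH] h; rewrite addSn.
exact: SilentS st (IH h).
Qed.

Lemma silent1 c c' : tm_step c = Some (c', None) -> silent 1 c c'.
Proof. by move=> h; apply: SilentS h (Silent0 _). Qed.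

Lemma silent_run n c c' k : silent n c c' ->
  tm_run (n + k) c = (nseq n None ++ (tm_run k c').1, (tm_run k c').2).
Proof.
elim=> [c0|m c0 c1 c2 st _ IH] /=; first by case: tm_run.
by rewrite st IH.
Qed.

Definition nonblank (w : seq sym) := all (predC1 blank) w.
Definition blanks (w : seq sym) := all (pred1 blank) w.

Lemma walk_right p u l w b : nonblank u ->
  (forall a, a \in u -> delta p a = Move p a DRight) ->
  silent (size u) (mk p l (u ++ w) b) (mk p (rev u ++ l) w b).
Proof.
elim: u l => [|a u IHu] l /=; first by move=> *; apply: Silent0.
move=> /andP [_ nu] hd; apply: SilentS.
  by rewrite step_mk hd ?mem_head.
rewrite rev_cons cat_rcons; apply: IHu => // x xu.
by apply: hd; rewrite inE xu orbT.
Qed.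

(** Here [u] starts with the cell under the head and runs leftwards; the extra step turns around on
    the blank. *)
Lemma walk_back pc u l w b : nonblank u -> blanks l ->
  silent (size u).+1
    (mk (inl (pc, false)) (behead (u ++ l)) (head blank (u ++ l) :: w) b)
    (mk (inl (pc, true)) (blank :: behead l) (rev u ++ w) b).
Proof.
elim: u w => [|a u IHu] w /=.
  move=> _ bl; apply: silent1; rewrite step_mk /=.
  have -> : head blank l = blank by case: l bl => //= x l /andP [/eqP].
  by rewrite eqxx.
move=> /andP [na nu] bl; apply: SilentS.
  by rewrite step_mk /= (negbTE na).
by rewrite rev_cons cat_rcons; apply: IHu.
Qed.

(** * Queues on the tape and execution of programs *)

Definition content (i : qname) (cells : seq sym) : seq letter :=
  pmap (fun a => if view a is Some (j, x) then (if j == i then Some x else None)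
                 else None) cells.

Definition holds (cells : seq sym) (st : store) : Prop :=
  forall i, content i cells = sget st i.

Lemma content_cat i u v : content i (u ++ v) = content i u ++ content i v.
Proof. exact: pmap_cat. Qed.

Lemma view_write i x : view (write i x) = Some (i, x).
Proof. by case: i x => [] [[[]|]|] //=; rewrite inordK. Qed.

Arguments write : simpl never.

Lemma write_nonblank i x : write i x != blank.
Proof.
by apply/eqP => /(congr1 view); rewrite view_write.
Qed.

Lemma content_QI i xs :
  content i [seq write QI x | x <- xs] = if i == QI then xs else [::].
Proof.
elim: xs => [|x xs IH] /=; first by case: eqP.
by rewrite view_write /= IH eq_sym; case: eqP.
Qed.

(** The letters of [QI] form a contiguous block at the right end. The erasing phase stops at the
    first of them, so this makes the remaining tape exactly the word for [M]. *)
Inductive tidy : seq sym -> Prop :=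
  | TidyQI xs : tidy [seq write QI x | x <- xs]
  | TidyCons a cells : (forall x, view a <> Some (QI, x)) -> tidy cells ->
      tidy (a :: cells).

Lemma tidy_push cells x : tidy cells -> tidy (rcons cells (write QI x)).
Proof.
elim=> [xs|a cells' na _ IH]; last exact: TidyCons.
by rewrite -map_rcons; apply: TidyQI.
Qed.

Lemma tidy_pop i x u a v : i <> QI -> view a = Some (i, x) ->
  tidy (u ++ a :: v) -> tidy (u ++ tomb :: v).
Proof.
move=> ni va; have not_qi xs : a \notin [seq write QI y | y <- xs].
  by apply/mapP => -[y _ ea]; rewrite ea view_write in va; case: va => /esym.
have sub (w : seq sym) : tidy w -> forall u', w = u' ++ a :: v -> tidy (u' ++ tomb :: v).
  elim=> [xs u' eq_w|b w' nb tw IH [|b' u'] /= [eb ew]].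
  - by have := not_qi xs; rewrite eq_w mem_cat mem_head orbT.
  - by apply: TidyCons; rewrite -?ew.
  - by apply: TidyCons; rewrite -?eb //; apply: IH.
by move=> /sub; apply.
Qed.

Lemma tidy_empty cells : content QI cells = [::] -> tidy cells.
Proof.
elim: cells => [|a cells IH] /=; first by move=> _; apply: (TidyQI [::]).
case va : (view a) => [[j x]|] => [|h]; last by apply: TidyCons; rewrite ?va //; apply: IH.
case: eqP => // nj h; apply: TidyCons; last exact: IH.
by move=> y; rewrite va => -[].
Qed.

(** The situation between two instructions: the head is back on the first cell of the content, with
    only blanks outside it. *)
Definition ready (pc : nat) (cells : seq sym) (c : config machine) : Prop :=
  exists l z, [/\ blanks l, blanks z & c = mk (goto pc true) l (cells ++ z) [::]].

Lemma mk_blanks p l z b : blanks z -> mk p l z b = mk p l (blank :: behead z) b.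
Proof. by case: z => //= x z /andP [/eqP ->]. Qed.

Lemma nth_blanks z i : blanks z -> nth blank z i = blank.
Proof.
move=> /allP bz; case: (ltnP i (size z)) => hi; last by rewrite nth_default.
by apply/eqP/bz/mem_nth.
Qed.

Lemma blanks_behead z : blanks z -> blanks (behead z).
Proof. by case: z => //= x z /andP []. Qed.

Lemma blanks_cons z : blanks z -> blanks (blank :: behead z).
Proof. exact: blanks_behead. Qed.

Lemma inord_pc k : k <= size prog -> nth IHalt prog (inord k : 'I_(size prog).+1) = nth IHalt prog k.
Proof. by move=> h; rewrite inordK. Qed.

Lemma run_push pc i x l cells c : pc < size prog ->
  nth IHalt prog pc = IPush i x l -> nonblank cells -> ready pc cells c ->
  exists c', silent (2 * size cells).+2 c c' /\ ready l (rcons cells (write i x)) c'.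
Proof.
move=> lt_pc eq_pc ncells [lf [z [bl bz ->]]].
exists (mk (goto l true) (blank :: behead lf) (rev (rev cells) ++ write i x :: behead z) [::]).
split; last first.
  exists (blank :: behead lf), (behead z); rewrite revK cat_rcons.
  by split=> //; rewrite ?blanks_cons ?blanks_behead.
have -> : (2 * size cells).+2 = size cells + (1 + (size (rev cells)).+1).
  by rewrite size_rev; lia.
apply: silent_trans.
  apply: walk_right => // a ac.
  rewrite /delta /goto inord_pc 1?ltnW // eq_pc ifF //.
  by apply/negbTE; apply: (allP ncells).
apply: silent_trans; last first.
  by apply: walk_back => //; rewrite /nonblank all_rev.
by apply: silent1; rewrite (mk_blanks _ _ _ bz) step_mk /= inord_pc 1?ltnW // eq_pc.
Qed.

Lemma content_split i cells :
  (content i cells = [::] /\ forall a, a \in cells ->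
     forall x, view a <> Some (i, x)) \/
  exists u a v x, [/\ cells = u ++ a :: v, view a = Some (i, x),
    content i u = [::] & forall b, b \in u -> forall y, view b <> Some (i, y)].
Proof.
elim: cells => [|a cells IH]; first by left.
case va : (view a) => [[j x]|].
  have [eji|nji] := eqVneq j i.
    by right; exists [::], a, cells, x; rewrite va eji.
  case: IH => [[c0 nc]|[u [a' [v [x' [-> va' cu nu]]]]]].
    left; rewrite /= va (negbTE nji); split=> // b; rewrite inE => /predU1P [->|/nc //] y.
    by rewrite va => -[/eqP]; rewrite (negbTE nji).
  right; exists (a :: u), a', v, x'; split=> //; first by rewrite /= va (negbTE nji).
  move=> b; rewrite inE => /predU1P [->|/nu //] y.
  by rewrite va => -[/eqP]; rewrite (negbTE nji).
case: IH => [[c0 nc]|[u [a' [v [x' [-> va' cu nu]]]]]].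
  left; rewrite /= va; split=> // b; rewrite inE => /predU1P [->|/nc //] y.
  by rewrite va.
right; exists (a :: u), a', v, x'; split=> //; first by rewrite /= va.
move=> b; rewrite inE => /predU1P [->|/nu //] y.
by rewrite va.
Qed.

Lemma run_pop pc i tbl cells c st : pc < size prog ->
  nth IHalt prog pc = IPop i tbl -> nonblank cells -> ready pc cells c ->
  holds cells st ->
  exists t c' cells',
    [/\ t <= (2 * size cells).+2, silent t c c',
        ready (tbl (ohead (sget st i))) cells' c',
        nonblank cells' /\ size cells' = size cells &
        holds cells' (spop st i) /\ (i <> QI -> tidy cells -> tidy cells')].
Proof.
move=> lt_pc eq_pc ncells [lf [z [bl bz ->]]] hold.
have stay (u : seq sym) : nonblank u ->
    (forall b, b \in u -> forall y, view b <> Some (i, y)) ->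
    forall b, b \in u -> delta (goto pc true) b = Move (goto pc true) b DRight.
  move=> nu hu b bu; rewrite /delta /goto inord_pc 1?ltnW // eq_pc.
  rewrite ifF; last by apply/negbTE; apply: (allP nu).
  case vb : (view b) => [[j y]|] //; case: eqP => // eji.
  by case: (hu b bu y); rewrite vb eji.
case: (content_split i cells) => [[c0 nc]|[u [a [v [x [eqc va cu nu]]]]]].
  exists (2 * size cells).+2,
    (mk (goto (tbl None) true) (blank :: behead lf) (rev (rev cells) ++ blank :: behead z) [::]), cells.
  split=> //.
  - have -> : (2 * size cells).+2 = size cells + (1 + (size (rev cells)).+1).
      by rewrite size_rev; lia.
    apply: silent_trans; first by apply: walk_right => //; apply: stay.
    apply: silent_trans; last first.
      by apply: walk_back => //; rewrite /nonblank all_rev.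
    by apply: silent1; rewrite (mk_blanks _ _ _ bz) step_mk /= inord_pc 1?ltnW // eq_pc.
  - rewrite -hold c0; exists (blank :: behead lf), (blank :: behead z).
    by rewrite revK; split=> //; rewrite ?blanks_cons.
  - split=> // j; rewrite sget_sset; case: eqP => [->|_]; last exact: hold.
    by rewrite -hold c0.
have nau : nonblank u /\ a != blank /\ nonblank v.
  by move: ncells; rewrite eqc /nonblank all_cat /= => /and3P [].
have [nu' [na nv]] := nau.
exists (2 * size u).+2,
  (mk (goto (tbl (Some x)) true) (blank :: behead lf) (rev (rev u) ++ tomb :: v ++ z) [::]),
  (u ++ tomb :: v).
split.
- by rewrite eqc size_cat /=; lia.
- have -> : (2 * size u).+2 = size u + (1 + (size (rev u)).+1).
    by rewrite size_rev; lia.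
  rewrite eqc -catA; apply: silent_trans; first by apply: walk_right => //; apply: stay.
  apply: silent_trans; last first.
    by apply: walk_back => //; rewrite /nonblank all_rev.
  apply: silent1; rewrite step_mk /= inord_pc 1?ltnW // eq_pc (negbTE na) va.
  by rewrite eqxx.
- have -> : ohead (sget st i) = Some x.
    by rewrite -hold eqc content_cat cu /= va eqxx.
  exists (blank :: behead lf), z; rewrite revK -catA.
  by split=> //; rewrite ?blanks_cons ?blanks_behead.
- by rewrite eqc !size_cat /nonblank all_cat /=; split=> //; apply/andP.
- split; last by move=> ni; rewrite eqc; apply: tidy_pop va.
  move=> j; rewrite sget_sset -!hold eqc !content_cat /= va; case: eqP => [->|nji].
    by rewrite cu eqxx.
  by rewrite ifF //; apply/eqP => e; apply: nji.
Qed.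

(** The time of [n] round trips on a tape that has [s] used cells at first and gains at most one per
    operation. *)
Definition sim_bound (s n : nat) := n * (2 * (s + n) + 2).

Lemma sim_bound_mono s s' n m : s <= s' -> n <= m -> sim_bound s n <= sim_bound s' m.
Proof. by move=> h1 h2; rewrite leq_mul // leq_add2r leq_mul2l leq_add. Qed.

Lemma sim_bound_add s n1 n2 :
  sim_bound s n1 + sim_bound (s + n1) n2 <= sim_bound s (n1 + n2).
Proof. by rewrite /sim_bound; nia. Qed.

(** By induction on the execution: a push or a pop is one round trip, and the costs of consecutive
    parts combine by [sim_bound_add], since the first part lengthens the tape by at most its own
    cost. *)
Lemma run_exec c st n st' : exec c st n st' ->
  forall k ex cells cf, placed prog c k ex -> nonblank cells -> holds cells st ->
  ready k cells cf ->
  exists t cf' cells',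
    [/\ t <= sim_bound (size cells) n, silent t cf cf', ready ex cells' cf',
        nonblank cells' /\ size cells' <= size cells + n &
        holds cells' st' /\ (out_only c -> tidy cells -> tidy cells')].
Proof.
elim=> {c st n st'}.
- move=> i x st k ex cells cf pl nc hc rc.
  have [cf' [sil rc']] := run_push (placed_lt pl) (placed_push pl) nc rc.
  exists (2 * size cells).+2, cf', (rcons cells (write i x)); split=> //.
  + by rewrite /sim_bound; lia.
  + by rewrite size_rcons addn1 /nonblank all_rcons /= write_nonblank; split.
  + split=> [|/= ->]; last exact: tidy_push.
    move=> j; rewrite sget_sset -cats1 content_cat /= view_write eq_sym -!hc.
    by case: eqP => [->|_] //; rewrite cats0.
- move=> c1 c2 st n1 st1 n2 st2 _ IH1 _ IH2 k ex cells cf pl nc hc rc.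
  have [pl1 pl2] := placed_seq pl.
  have [t1 [cf1 [cells1 [le1 sil1 rc1 [nc1 sz1] [hc1 td1]]]]] := IH1 _ _ _ _ pl1 nc hc rc.
  have [t2 [cf2 [cells2 [le2 sil2 rc2 [nc2 sz2] [hc2 td2]]]]] := IH2 _ _ _ _ pl2 nc1 hc1 rc1.
  exists (t1 + t2), cf2, cells2; split=> //.
  + apply: leq_trans (sim_bound_add _ _ _); rewrite leq_add //.
    exact: leq_trans le2 (sim_bound_mono _ _).
  + exact: silent_trans sil1 sil2.
  + by split=> //; lia.
  + by split=> // -[o1 o2] td; apply/td2/td1.
- move=> i sx body st hx k ex cells cf pl nc hc rc.
  have [eqk _] := placed_for pl.
  have [t [cf' [cells' [le sil rc' [nc' sz'] [hc' td']]]]] := run_pop (placed_lt pl) eqk nc rc hc.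
  exists t, cf', cells'; split=> //.
  + by apply: leq_trans le _; rewrite /sim_bound; lia.
  + by move: rc'; rewrite /for_label hx.
  + by split=> //; lia.
  + by split=> // -[ni _] td; apply: td'.
- move=> i sx body st x n1 st1 n2 st2 hx nx _ IH1 _ IH2 k ex cells cf pl nc hc rc.
  have [eqk plb] := placed_for pl.
  have [t [cf' [cells' [le sil rc' [nc' sz'] [hc' td']]]]] := run_pop (placed_lt pl) eqk nc rc hc.
  rewrite hx in rc'.
  have [t1 [cf1 [cells1 [le1 sil1 rc1 [nc1 sz1] [hc1 td1]]]]] := IH1 _ _ _ _ (plb x nx) nc' hc' rc'.
  have [t2 [cf2 [cells2 [le2 sil2 rc2 [nc2 sz2] [hc2 td2]]]]] := IH2 _ _ _ _ pl nc1 hc1 rc1.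
  exists (t + (t1 + t2)), cf2, cells2; split=> //.
  + rewrite sz' in le1 sz1.
    have := leq_trans le2 (sim_bound_mono sz1 (leqnn n2)).
    have := sim_bound_add (size cells) n1 n2.
    move: le le1; rewrite /sim_bound; nia.
  + exact: silent_trans sil (silent_trans sil1 sil2).
  + by split=> //; lia.
  + split=> // o td; apply: td2 => //; apply: td1; first by case: o => _; apply.
    by apply: td' => //; case: o.
- move=> c st n m st' _ IH le_nm k ex cells cf pl nc hc rc.
  have [t [cf' [cells' [le sil rc' [nc' sz'] [hc' td']]]]] := IH _ _ _ _ pl nc hc rc.
  exists t, cf', cells'; split=> //.
  + exact: leq_trans le (sim_bound_mono _ _).
  + by split=> //; lia.
Qed.

(** Every cell before the block of [QI] turns into a blank and joins those on the left. Nonemptiness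
    of [xs] makes the sweep stop. *)
Lemma run_erase cells xs l z : tidy cells -> content QI cells = xs -> xs <> [::] ->
  blanks l -> exists t l', [/\ t <= (size cells).+1, blanks l' &
    silent t (mk (inr None) l (cells ++ z) [::])
      (mk (inr (Some (ord0, None))) l' ([seq write QI x | x <- xs] ++ z) [::])].
Proof.
move=> td; elim: td l => [ys|a c na _ IH] l /=.
  rewrite content_QI /= => <-; case: ys => [|y ys] // _ bl; exists 1, l; split=> //.
  by apply: silent1; rewrite step_mk /delta view_write.
have keep : (if view a is Some (j, x) then if j == QI then Some x else None else None) = None.
  by case: view na => [[j x]|] // na; case: eqP => // ej; case: (na x); rewrite ej.
rewrite /oapp keep => ex nx bl.
have [//|t [l' [le bl' sil]]] := IH (blank :: l) ex nx.
exists t.+1, l'; split=> //; apply: SilentS sil; rewrite step_mk /delta.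
by case va : (view a) na => [[[] x]|] // na; case: (na x).
Qed.

(** * Initial configuration and simulation of the given machine *)

Lemma init_mk (ys : seq (option bool)) :
  tm_init machine (map plain_code ys) =
  mk start [::] [seq write QI (Some y) | y <- ys] [::].
Proof.
have enc y : enc_sym (write QI (Some y)) = inord (plain_code y).
  by apply: val_inj; rewrite /= !inordK //; case: y => [[]|].
have -> : @tm_init machine (map plain_code ys) =
    Config (ord0 : 'I_(tm_q machine).+1) [::]
      (head ord0 (map enc_sym [seq write QI (Some y) | y <- ys]))
      (behead (map enc_sym [seq write QI (Some y) | y <- ys])) [::].
  rewrite /tm_init -!map_comp; congr Config.
    by congr head; apply: eq_map => y; apply: esym (enc y).
  by congr behead; apply: eq_map => y; apply: esym (enc y).
by rewrite /mk head_map_sym -behead_map /enc_state eqxx.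
Qed.

(** Tapes are compared cell by cell through [nth], because the combined machine may carry explicit
    blanks where the list of [M] has ended. The filter mode lives in the state and the filtered bits
    in the buffer. *)
Definition simulates (c : config M) (c' : config machine) : Prop :=
  exists l w, [/\ forall i, nth blank l i = inl (nth ord0 (c_left c) i),
    forall i, nth blank w i = inl (nth ord0 (c_head c :: c_right c) i) &
    c' = mk (inr (Some (c_state c, (filter_run (c_buf c)).1))) l w
           (filter_out (c_buf c))].

Lemma filter_run_rcons b x : filter_run (rcons b x) = filter_step (filter_run b) x.
Proof. by rewrite /filter_run -cats1 foldl_cat. Qed.

Lemma simulates_step c c' : simulates c c' ->
  match tm_step c with
  | None => tm_step c' = None
  | Some (c1, e) =>
      exists c1', tm_step c' = Some (c1', omap filter_out e) /\ simulates c1 c1'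
  end.
Proof.
case: c => q l h r b [l' [w [/= hl hw ->]]].
(* If [w] is empty, then [h] is blank, and writing the head cell explicitly leaves the configuration
   unchanged. *)
have -> : forall p l0 b0, mk p l0 w b0 = mk p l0 (inl h :: behead w) b0.
  by move=> p l0 b0; rewrite /mk /=; have := hw 0; rewrite nth0 /= => ->.
have hr i : nth blank (behead w) i = inl (nth ord0 r i) by rewrite nth_behead hw.
have hl0 : head blank l' = inl (head ord0 l) by rewrite -!nth0 hl.
rewrite step_mk /tm_step /=.
case: (tm_delta q h) => [q' x d|q' x|q'|] //=.
- eexists; split; first by [].
  case: d.
  + exists (behead l'), (head blank l' :: inl x :: behead w); split=> //= i.
      by rewrite !nth_behead.
    by case: i => [|[|i]] /=.
  + exists (inl x :: l'), (behead w); split=> //= i; first by case: i => /=.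
    by rewrite hr; case: i => [|i] /=; rewrite ?nth0 ?nth_behead.
  + by exists l', (inl x :: behead w); split=> //= -[|i] /=.
- set m := filter_run b; have eqm : filter_run (rcons b x) = filter_step m x.
    exact: filter_run_rcons.
  have hd i : nth blank (inl h :: behead w) i = inl (nth ord0 (h :: r) i).
    by case: i => /=.
  move: eqm; rewrite /filter_step.
  case em : m.1 => [[]|] eqm; eexists; split; (try by []);
    exists l', (inl h :: behead w); split=> //=; rewrite /filter_out eqm //=;
    by rewrite -/(filter_run b).
- eexists; split; first by [].
  by exists l', (inl h :: behead w); split=> //= -[|i] /=.
Qed.

Lemma simulates_run k c c' : simulates c c' ->
  tm_run k c' = (map (omap filter_out) (tm_run k c).1, (tm_run k c).2).
Proof.
elim: k c c' => [//|k IH] c c' /simulates_step /=.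
case: (tm_step c) => [[c1 e] [c1' [-> sim]]|-> //].
by rewrite (IH _ _ sim).
Qed.

End Machine.

(** * The queue program computing the reduction *)

Declare Scope cmd_scope.
Notation "c1 ;; c2" := (Seq c1 c2) (at level 60, right associativity) : cmd_scope.
Local Open Scope cmd_scope.

Definition bit (b : bool) : letter := Some (Some b).
Definition sep : letter := Some None.
Definition eoq : letter := None.

Definition mat (rows : seq (seq bool)) : seq (option bool) :=
  flatten [seq rcons (map Some r) None | r <- rows].

(* A queue read cyclically ends with [eoq], so that one pass of [For] is one
   rotation. *)
Definition circ (w : seq (option bool)) : seq letter := map Some w ++ [:: eoq].

(** The separators on [QE] count the edges, so one rotation emits a zero for each edge column. *)
Definition zeros : cmd :=
  For QE false (fun x => if x is None then Push QE sep ;; Push QO (bit false)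
                         else Push QE (Some x)) ;;
  Push QE eoq.

Definition pairs (f g : option bool -> letter) : cmd :=
  For QN false (fun x => Push QN (Some x) ;; Push QO (f x) ;; Push QO (g x)) ;;
  Push QN eoq.

(** Moves the first bit of each row to the output; repeating this once per element transposes the
    incidence matrix column by column. *)
Definition column : cmd :=
  For QE false (fun x =>
    Push QO (Some x) ;; For QE true (fun y => Push QE (Some y)) ;; Push QE sep) ;;
  Push QE eoq.

(** The pieces follow the vertex order: [f] and [g] give the pendant and element columns, [a] the
    hub, [b] the two last pendants, and [tail] the edges. *)
Definition row (f g : option bool -> letter) (a b : bool) (tail : cmd) : cmd :=
  pairs f g ;; Push QO (bit a) ;; Push QO (bit b) ;; Push QO (bit b) ;; tail ;;
  Push QO sep.

Definition pend_row : cmd := row (fun=> bit false) (fun=> bit false) true false zeros.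
(** The letter on [QN] is copied because in round [i] that word is the adjacency of element [i] to
    the elements. *)
Definition elt_row : cmd := row (fun=> bit false) Some true false column.
Definition hub_row : cmd := row (fun=> bit true) (fun=> bit true) false true zeros.

(* Shifts the word on [QN] by one place: the letter on [QP] enters at the front
   and the last letter is left on [QP]. *)
Definition shift : cmd :=
  For QN false (fun x => For QP false (fun y => Push QN (Some y)) ;; Push QP (Some x)) ;;
  Push QN eoq.

(** The matrix is stored twice: [QE] is rotated and loses its columns, while [QF] keeps the rows
    intact for the edge vertices. *)
Definition read : cmd :=
  For QI true (fun=> Push QN (bit true)) ;; Push QN eoq ;;
  For QI false (fun x => Push QE (Some x) ;; Push QF (Some x)) ;; Push QE eoq.

(* During round [i], [QN] holds the word of length [n] whose only zero is at
   place [i]; that zero is shifted out in round [n - 1], which ends the loop. *)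
Definition elt_loop : cmd :=
  For QP false (fun x =>
    if x is Some true then pend_row ;; elt_row ;; Push QP (bit true) ;; shift
    else Push QP eoq).

Definition elt_rows : cmd := Push QP (bit false) ;; shift ;; elt_loop.

Definition edge_rows : cmd :=
  For QF false (fun x =>
    if x is None then
      Push QO (bit false) ;; Push QO (bit false) ;; Push QO (bit false) ;; zeros ;;
      Push QO sep
    else Push QO (bit false) ;; Push QO (Some x)).

Definition build : cmd :=
  read ;; elt_rows ;; hub_row ;; pend_row ;; pend_row ;; edge_rows.

(** The result is moved to [QI] only after all other work, so that it lies in one block at the right
    end of the tape. *)
Definition output : cmd := For QO false (fun x => Push QI (Some x)).

(** * Effect and cost of the subprograms *)

Lemma ESeq_le c1 c2 st n1 st1 n2 st2 m : exec c1 st n1 st1 -> exec c2 st1 n2 st2 ->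
  n1 + n2 <= m -> exec (Seq c1 c2) st m st2.
Proof. by move=> h1 h2; apply: ELe (ESeq h1 h2). Qed.

Lemma EPushSeq i x c st n st' :
  exec c (spush st i x) n st' -> exec (Push i x ;; c) st n.+1 st'.
Proof. by move=> h; apply: ESeq_le (EPush _ _ _) h _. Qed.

Lemma EPush_eq i x st st' : spush st i x = st' -> exec (Push i x) st 1 st'.
Proof. by move=> <-; apply: EPush. Qed.

Lemma exec_zeros I N w F P O :
  exec zeros (Store I N (circ w) F P O) (3 * size w).+2
    (Store I N (circ w) F P (O ++ nseq (count_mem None w) (bit false))).
Proof.
(* The letters already rotated, [acc], wait behind the end marker. *)
suff loop acc : exec (For QE false (fun x =>
      if x is None then Push QE sep ;; Push QO (bit false) else Push QE (Some x)))
    (Store I N (map Some w ++ eoq :: acc) F P O) (3 * size w).+1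
    (Store I N (acc ++ map Some w) F P (O ++ nseq (count_mem None w) (bit false))).
  by apply: ESeq_le (loop [::]) (EPush _ _ _) _; rewrite addn1.
elim: w acc O => [|x w IH] acc O.
  by rewrite /= !cats0; apply: EForExit.
apply: ELe.
  apply: (@EForStep _ _ _ _ x); [by [] | by case: x |  | ].
  - instantiate (2 := 2).
    instantiate (1 := Store I N (map Some w ++ eoq :: (acc ++ [:: Some x])) F P
      (O ++ nseq (x == None) (bit false))).
    case: x => [b|] /=.
      by apply: ELe (EPush_eq _) _ => //; rewrite /spush /= cats0 -catA.
    by apply: EPushSeq; apply: EPush_eq; rewrite /spush /= -catA.
  - have := IH (acc ++ [:: Some x]) (O ++ nseq (x == None) (bit false)).
    by rewrite -!catA -nseqD; apply.
by rewrite /=; lia.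
Qed.

Lemma exec_pairs f g I w E F P O :
  exec (pairs f g) (Store I (circ w) E F P O) (4 * size w).+2
    (Store I (circ w) E F P (O ++ flatten [seq [:: f x; g x] | x <- w])).
Proof.
suff loop acc : exec (For QN false (fun x => Push QN (Some x) ;; Push QO (f x) ;; Push QO (g x)))
    (Store I (map Some w ++ eoq :: acc) E F P O) (4 * size w).+1
    (Store I (acc ++ map Some w) E F P (O ++ flatten [seq [:: f x; g x] | x <- w])).
  by apply: ESeq_le (loop [::]) (EPush _ _ _) _; rewrite addn1.
elim: w acc O => [|x w IH] acc O.
  by rewrite /= !cats0; apply: EForExit.
apply: ELe.
  apply: (@EForStep _ _ _ _ x); [by [] | by case: x | | ].
  - by do 2!apply: EPushSeq; apply: EPush.
  - have := IH (acc ++ [:: Some x]) (O ++ [:: f x; g x]).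
    rewrite /spush /= -!catA /=; apply.
by rewrite /=; lia.
Qed.

Lemma exec_column I N rows F P O : all (fun r => 0 < size r) rows ->
  exec column (Store I N (circ (mat rows)) F P O) (4 * size (mat rows)).+2
    (Store I N (circ (mat (map behead rows))) F P
       (O ++ [seq bit (head false r) | r <- rows])).
Proof.
move=> nz; suff loop acc : exec (For QE false (fun x =>
      Push QO (Some x) ;; For QE true (fun y => Push QE (Some y)) ;; Push QE sep))
    (Store I N (map Some (mat rows) ++ eoq :: acc) F P O) (4 * size (mat rows)).+1
    (Store I N (acc ++ map Some (mat (map behead rows))) F P
       (O ++ [seq bit (head false r) | r <- rows])).
  by apply: ESeq_le (loop [::]) (EPush _ _ _) _; rewrite addn1.
have inner r acc' O' : exec (For QE true (fun y => Push QE (Some y)))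
    (Store I N (map bit r ++ sep :: acc') F P O') (2 * size r).+1
    (Store I N (acc' ++ map bit r) F P O').
  elim: r acc' => [|b r IH] acc'; first by rewrite /= cats0; apply: EForExit.
  apply: ELe.
    apply: (@EForStep _ _ _ _ (Some b)) => //; first exact: EPush.
    have := IH (acc' ++ [:: bit b]).
    by rewrite /spush /= -!catA /=; apply.
  by rewrite /=; lia.
elim: rows nz acc O => [|[//|b r] rows IH] /= nz acc O.
  by rewrite !cats0; apply: EForExit.
apply: ELe.
  apply: (@EForStep _ _ _ _ (Some b)) => //.
  - apply: EPushSeq; apply: ESeq; last exact: EPush.
    have := inner r (map Some (mat rows) ++ eoq :: acc) (O ++ [:: bit b]).
    by rewrite /spush /= map_cat map_rcons -map_comp cat_rcons -!catA; apply.
  - have := IH nz (acc ++ map bit r ++ [:: sep]) (O ++ [:: bit b]).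
    rewrite /spush /= !map_cat map_rcons -map_comp -cats1 -!catA /= -!catA; apply.
by rewrite /= -/(mat rows) size_cat size_rcons size_map; lia.
Qed.

(** Each letter swaps with the one carried on [QP], so the queue turns from [w] into [p :: w]
    without its last letter. *)
Lemma exec_shift I w E F p O :
  exec shift (Store I (circ w) E F [:: Some p] O) (5 * size w).+2
    (Store I (circ (belast p w)) E F [:: Some (last p w)] O).
Proof.
suff loop acc : exec (For QN false (fun x =>
      For QP false (fun y => Push QN (Some y)) ;; Push QP (Some x)))
    (Store I (map Some w ++ eoq :: acc) E F [:: Some p] O) (5 * size w).+1
    (Store I (acc ++ map Some (belast p w)) E F [:: Some (last p w)] O).
  by apply: ESeq_le (loop [::]) (EPush _ _ _) _; rewrite addn1.
elim: w p acc => [|x w IH] p acc.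
  by rewrite /= !cats0; apply: EForExit.
apply: ELe.
  apply: (@EForStep _ _ _ _ x); [by [] | by case: x | | ].
  - apply: ESeq; last exact: EPush.
    apply: (@EForStep _ _ _ _ p); [by [] | by case: p | exact: EPush | exact: EForExit].
  - have := IH x (acc ++ [:: Some p]).
    by rewrite /spush /= -!catA /=; apply.
by rewrite /=; lia.
Qed.

Lemma exec_row f g a b tail I w E E' F P O m T :
  (forall O', exec tail (Store I (circ w) E F P O') m
                (Store I (circ w) E' F P (O' ++ T))) ->
  exec (row f g a b tail) (Store I (circ w) E F P O) (4 * size w + m + 6)
    (Store I (circ w) E' F P (O ++ flatten [seq [:: f x; g x] | x <- w]
       ++ [:: bit a; bit b; bit b] ++ T ++ [:: sep])).
Proof.
move=> htail; apply: ESeq_le.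
- exact: exec_pairs.
- do 3!apply: EPushSeq; apply: ESeq; first exact: htail.
  by apply: EPush_eq; rewrite /spush /= -!catA.
- by lia.
Qed.

Lemma map_cst (A B : Type) (c : B) (s : seq A) : [seq c | _ <- s] = nseq (size s) c.
Proof. by elim: s => //= _ s ->. Qed.

Lemma count_sep_mat rows : count_mem None (mat rows) = size rows.
Proof.
elim: rows => //= r rows IH; rewrite count_cat -cats1 count_cat IH /=.
by rewrite count_map (eq_count (a2 := pred0)) ?count_pred0.
Qed.

Lemma size_mat_drop i rows : size (mat (map (drop i) rows)) <= size (mat rows).
Proof.
elim: rows => //= r rows IH; rewrite !size_cat !size_rcons !size_map size_drop.
by rewrite leq_add // ltnS leq_subr.
Qed.

Lemma one_zero_word i j :
  nseq i true ++ false :: nseq j true = [seq i != k | k <- iota 0 (i + j.+1)].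
Proof.
rewrite iotaD map_cat /= eqxx /=; congr (_ ++ _ :: _).
  rewrite -[in LHS](size_iota 0 i) -map_cst; apply/eq_in_map => k.
  by rewrite mem_iota /=; lia.
rewrite -[in LHS](size_iota i.+1 j) -map_cst; apply/eq_in_map => k.
by rewrite mem_iota; lia.
Qed.

(** * Rows of the adjacency matrix and the whole program *)

Section Rows.
Variables (n : nat) (rows : seq (seq bool)).
Hypothesis size_rows : all (fun r => size r == n) rows.
Let ks := kinds n rows.

Definition krow (a : kind) : seq letter := rcons [seq bit (kadj a b) | b <- ks] sep.

Lemma krowE a : krow a =
  flatten [seq [:: bit (kadj a Pend); bit (kadj a (Elt k))] | k <- iota 0 n]
  ++ [:: bit (kadj a Hub); bit (kadj a Pend); bit (kadj a Pend)]
  ++ [seq bit (kadj a (Edg r)) | r <- rows] ++ [:: sep].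
Proof.
by rewrite /krow /ks /kinds -cats1 !map_cat map_flatten -!map_comp -!catA.
Qed.

(** Covers pendants and the hub alike: neither distinguishes elements from pendants, and neither is
    adjacent to an edge vertex. *)
Lemma exec_uniform_row a b c I w rows' F P O : size w = n -> size rows' = size rows ->
  (forall k, kadj a (Elt k) = kadj a Pend) -> (forall r, kadj a (Edg r) = false) ->
  kadj a Pend = b -> kadj a Hub = c ->
  exec (row (fun=> bit b) (fun=> bit b) c b zeros)
    (Store I (circ w) (circ (mat rows')) F P O)
    (4 * n + 3 * size (mat rows') + 8)
    (Store I (circ w) (circ (mat rows')) F P (O ++ krow a)).
Proof.
move=> szw szr aE aR aP aH.
have := exec_row (fun=> bit b) (fun=> bit b) c b O
  (fun O' => exec_zeros I (circ w) (mat rows') F P O').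
rewrite count_sep_mat szr szw.
suff -> : krow a = flatten [seq [:: bit b; bit b] | _ <- w] ++
    [:: bit c; bit b; bit b] ++ nseq (size rows) (bit false) ++ [:: sep].
  by move=> h; apply: ELe h _; lia.
rewrite krowE aP aH; congr (flatten _ ++ _).
  rewrite map_cst szw -[in RHS](size_iota 0 n) -map_cst; apply: eq_map => k.
  by rewrite aE aP.
by rewrite -map_cst; congr [:: _, _, _ & _ ++ _]; apply: eq_map => r; rewrite aR.
Qed.

Lemma exec_pend_row I w rows' F P O : size w = n -> size rows' = size rows ->
  exec pend_row (Store I (circ w) (circ (mat rows')) F P O)
    (4 * n + 3 * size (mat rows') + 8)
    (Store I (circ w) (circ (mat rows')) F P (O ++ krow Pend)).
Proof. by move=> *; apply: exec_uniform_row. Qed.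

Lemma exec_hub_row I w rows' F P O : size w = n -> size rows' = size rows ->
  exec hub_row (Store I (circ w) (circ (mat rows')) F P O)
    (4 * n + 3 * size (mat rows') + 8)
    (Store I (circ w) (circ (mat rows')) F P (O ++ krow Hub)).
Proof. by move=> *; apply: exec_uniform_row. Qed.

Lemma exec_elt_row i j I F P O : i + j.+1 = n ->
  exec elt_row
    (Store I (circ (map Some (nseq i true ++ false :: nseq j true)))
       (circ (mat (map (drop i) rows))) F P O)
    (4 * n + 4 * size (mat rows) + 8)
    (Store I (circ (map Some (nseq i true ++ false :: nseq j true)))
       (circ (mat (map (drop i.+1) rows))) F P (O ++ krow (Elt i))).
Proof.
move=> def_n; set w := map Some _.
have nz : all (fun r => 0 < size r) (map (drop i) rows).
  apply/allP => r /mapP [r' /(allP size_rows) /eqP szr' ->].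
  by rewrite size_drop szr'; lia.
have := exec_row (fun=> bit false) Some true false O
  (fun O' => exec_column I (circ w) F P O' nz).
have -> : map behead (map (drop i) rows) = map (drop i.+1) rows.
  rewrite -map_comp; apply: eq_map => r /=.
  by rewrite -drop1 drop_drop add1n.
suff -> : krow (Elt i) = flatten [seq [:: bit false; Some x] | x <- w] ++
    [:: bit true; bit false; bit false] ++
    [seq bit (head false r) | r <- map (drop i) rows] ++ [:: sep].
  move=> h; apply: ELe h _; have := size_mat_drop i rows.
  by rewrite /w size_map size_cat /= !size_nseq; lia.
rewrite krowE /w one_zero_word def_n -!map_comp; congr (flatten _ ++ [:: _, _, _ & _ ++ _]).
by apply: eq_map => r; rewrite /= -nth0 nth_drop addn0.
Qed.

(** One round of [elt_loop] costs at most [13 * n + 7 * m + 20], where [m] is the size of the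
    matrix. *)
Definition round_cost : nat := 20 * (n + size (mat rows) + 1).

Lemma exec_elt_stop I N E F O :
  exec elt_loop (Store I N E F [:: bit false] O) 3 (Store I N E F [::] O).
Proof.
apply: ELe.
  apply: (@EForStep _ _ _ _ (Some false)) => //; first exact: EPush.
  exact: EForExit.
by [].
Qed.

Lemma exec_elt_loop i j I F O : i + j.+1 = n ->
  exec elt_loop
    (Store I (circ (map Some (nseq i true ++ false :: nseq j true)))
       (circ (mat (map (drop i) rows))) F [:: bit true] O)
    (j.+1 * round_cost + 3)
    (Store I (circ (nseq n (Some true))) (circ (mat (map (drop n) rows))) F [::]
       (O ++ flatten [seq krow Pend ++ krow (Elt k) | k <- iota i j.+1])).
Proof.
elim: j i O => [|j IH] i O def_n.
all: have szw k : i + k = n.-1 -> size (map Some (nseq i true ++ false :: nseq k true)) = n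
  by move=> ?; rewrite size_map size_cat /= !size_nseq; lia.
all: have le_mat := size_mat_drop i rows.
- apply: ELe.
    apply: (@EForStep _ _ _ _ (Some true)) => //; last exact: exec_elt_stop.
    apply: ESeq; first by apply: exec_pend_row; [apply: szw; lia | rewrite size_map].
    apply: ESeq; first exact: exec_elt_row.
    apply: EPushSeq; rewrite /spush /=.
    have := exec_shift I (map Some (nseq i true ++ false :: nseq 0 true)) (circ (mat (map (drop i.+1) rows)))
      F (Some true) ((O ++ krow Pend) ++ krow (Elt i)).
    rewrite szw; last by lia.
    rewrite -[nseq 0 true]/[::] last_map last_cat /=.
    (* In the last round the zero is in last place: it moves to [QP], where it ends the loop, and
       [QN] is left with ones only. *)
    have -> : belast (Some true) (map Some (nseq i true ++ [:: false])) = nseq n (Some true).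
      by rewrite cats1 map_rcons belast_rcons map_nseq -def_n addn1.
    rewrite -def_n addn1 cats0 catA; apply.
  by rewrite /round_cost; lia.
apply: ELe.
  apply: (@EForStep _ _ _ _ (Some true)) => //; last first.
    have := IH i.+1 ((O ++ krow Pend) ++ krow (Elt i)).
    rewrite -[iota i j.+2]/(i :: iota i.+1 j.+1) /= -!catA; apply; lia.
  apply: ESeq; first by apply: exec_pend_row; [apply: szw; lia | rewrite size_map].
  apply: ESeq; first exact: exec_elt_row.
  apply: EPushSeq; rewrite /spush /=.
  have := exec_shift I (map Some (nseq i true ++ false :: nseq j.+1 true))
    (circ (mat (map (drop i.+1) rows))) F (Some true) ((O ++ krow Pend) ++ krow (Elt i)).
  rewrite szw; last by lia.
  have -> : map Some (nseq i true ++ false :: nseq j.+1 true) =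
      rcons (map Some (nseq i true ++ false :: nseq j true)) (Some true).
    by rewrite -map_rcons rcons_cat rcons_cons -cats1 -(nseqD j 1) addn1.
  by rewrite last_rcons belast_rcons -!catA; apply.
by rewrite /round_cost; lia.
Qed.

Lemma exec_elt_rows I F O :
  exec elt_rows
    (Store I (circ (nseq n (Some true))) (circ (mat rows)) F [::] O)
    (n.+1 * round_cost)
    (Store I (circ (nseq n (Some true))) (circ (mat (map (drop n) rows))) F [::]
       (O ++ flatten [seq krow Pend ++ krow (Elt k) | k <- iota 0 n])).
Proof.
have drop_0 : map (drop 0) rows = rows.
  by rewrite -[RHS]map_id; apply: eq_map => r; rewrite drop0.
have := exec_shift I (nseq n (Some true)) (circ (mat rows)) F (Some false) O.
rewrite size_nseq => sh; case def_n : n sh => [|j] sh.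
  (* For [n = 0] the shift leaves the zero on [QP], and the loop stops without a round. *)
  rewrite drop_0 cats0; apply: ELe.
    by apply: EPushSeq; apply: ESeq; [exact: sh | exact: exec_elt_stop].
  by rewrite /round_cost def_n; lia.
have lp := @exec_elt_loop 0 j I F O (esym def_n).
have eb : belast (Some false) (nseq j.+1 (Some true)) =
    map Some (nseq 0 true ++ false :: nseq j true).
  by rewrite /= map_nseq; congr cons; elim: j {sh lp def_n} => //= j ->.
have el : last (Some false) (nseq j.+1 (Some true)) = Some true.
  by elim: j {sh lp def_n eb} => //= j; case: j.
rewrite drop_0 def_n in lp; rewrite eb el in sh.
apply: ELe.
  by apply: EPushSeq; apply: ESeq; [exact: sh | exact: lp].
by rewrite /round_cost def_n; lia.
Qed.

Lemma exec_edge_rows I N rows' P O : size rows' = size rows ->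
  exec edge_rows
    (Store I N (circ (mat rows')) (map Some (mat rows)) P O)
    (size (mat rows) * (3 * size (mat rows') + 10)).+1
    (Store I N (circ (mat rows')) [::] P
       (O ++ flatten [seq krow (Edg r) | r <- rows])).
Proof.
move=> szr'.
have bits (r : seq bool) F' O' m st :
    exec edge_rows (Store I N (circ (mat rows')) F' P
      (O' ++ flatten [seq [:: bit false; bit b] | b <- r])) m st ->
    exec edge_rows (Store I N (circ (mat rows')) (map bit r ++ F') P O')
      (3 * size r + m) st.
  elim: r O' => [|b r IH] O' h; first by rewrite cats0 in h.
  apply: ELe.
    apply: (@EForStep _ _ _ _ (Some b)) => //.
      by apply: EPushSeq; apply: EPush.
    by apply: IH; rewrite -!catA.
  by rewrite /=; lia.
rewrite /mat -/(mat rows'); move: size_rows.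
(* The induction runs over the rows still to be read, while [krow] keeps referring to all of
   [rows]. *)
elim: rows O => [|r rs IH] O /=; first by rewrite cats0 => _; apply: EForExit.
move=> /andP [/eqP szr all_rs].
rewrite map_cat map_rcons -map_comp cat_rcons; apply: ELe.
  apply: bits; apply: (@EForStep _ _ _ _ None) => //.
    do 3!apply: EPushSeq; apply: ESeq; first exact: exec_zeros.
    exact: EPush.
  have -> : krow (Edg r) = flatten [seq [:: bit false; bit b] | b <- r] ++
      [:: bit false; bit false; bit false] ++ nseq (size rows) (bit false) ++ [:: sep].
    rewrite krowE; congr (flatten _ ++ [:: _, _, _ & _ ++ _]).
      by rewrite -[in RHS](mkseq_nth false r) szr /mkseq -map_comp.
    by rewrite -map_cst.
  have := IH (O ++ flatten [seq [:: bit false; bit b] | b <- r] ++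
      [:: bit false; bit false; bit false] ++ nseq (size rows) (bit false) ++ [:: sep]) all_rs.
  by rewrite /spush /= count_sep_mat szr' -!catA /= -!catA; apply.
rewrite /= size_cat size_rcons size_map; lia.
Qed.

Lemma exec_read :
  exec read (Store (map bit (nseq n true) ++ sep :: map Some (mat rows))
      [::] [::] [::] [::] [::])
    (2 * n + 3 * size (mat rows) + 4)
    (Store [::] (circ (nseq n (Some true))) (circ (mat rows)) (map Some (mat rows))
       [::] [::]).
Proof.
have header k W N : exec (For QI true (fun=> Push QN (bit true)))
    (Store (map bit (nseq k true) ++ sep :: W) N [::] [::] [::] [::]) (2 * k).+1
    (Store W (N ++ nseq k (bit true)) [::] [::] [::] [::]).
  elim: k N => [|k IH] N; first by rewrite cats0; apply: EForExit.
  apply: ELe.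
    apply: (@EForStep _ _ _ _ (Some true)) => //; first exact: EPush.
    by have := IH (N ++ [:: bit true]); rewrite -catA; apply.
  by lia.
have body w N E F : exec (For QI false (fun x => Push QE (Some x) ;; Push QF (Some x)))
    (Store (map Some w) N E F [::] [::]) (3 * size w).+1
    (Store [::] N (E ++ map Some w) (F ++ map Some w) [::] [::]).
  elim: w E F => [|x w IH] E F; first by rewrite /= !cats0; apply: EForExit.
  apply: ELe.
    apply: (@EForStep _ _ _ _ x); [by [] | by case: x | | ].
      by apply: EPushSeq; apply: EPush.
    by have := IH (E ++ [:: Some x]) (F ++ [:: Some x]); rewrite -!catA; apply.
  by rewrite /=; lia.
apply: ELe.
  apply: ESeq; first exact: header.
  apply: EPushSeq; apply: ESeq; first exact: body.
  by apply: EPush_eq; rewrite /spush /= /circ map_nseq.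
by lia.
Qed.

Definition build_cost : nat := 80 * (n + size (mat rows) + 1) ^ 2.

Lemma exec_build :
  exists E, exec build
    (Store (map bit (nseq n true) ++ sep :: map Some (mat rows))
      [::] [::] [::] [::] [::])
    build_cost
    (Store [::] (circ (nseq n (Some true))) E [::] [::]
       (flatten [seq krow a | a <- kinds n rows])).
Proof.
exists (circ (mat (map (drop n) rows))).
have szd : size (map (drop n) rows) = size rows by rewrite size_map.
have szw : size (nseq n (Some true)) = n by rewrite size_nseq.
have le_mat := size_mat_drop n rows.
apply: ELe.
  apply: ESeq; first exact: exec_read.
  apply: ESeq; first exact: exec_elt_rows.
  apply: ESeq; first exact: exec_hub_row.
  apply: ESeq; first exact: exec_pend_row.
  apply: ESeq; first exact: exec_pend_row.
  have := exec_edge_rows [::] (circ (nseq n (Some true))) [::]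
    ((((flatten [seq krow Pend ++ krow (Elt k) | k <- iota 0 n]) ++ krow Hub)
      ++ krow Pend) ++ krow Pend) szd.
  suff -> : flatten [seq krow a | a <- kinds n rows] =
    ((((flatten [seq krow Pend ++ krow (Elt k) | k <- iota 0 n]) ++ krow Hub)
      ++ krow Pend) ++ krow Pend) ++ flatten [seq krow (Edg r) | r <- rows] by apply.
  rewrite /kinds !map_cat !flatten_cat /= -!catA; congr (_ ++ _); last by rewrite -map_comp.
  by elim: (iota 0 n) => //= k s ->; rewrite catA.
by rewrite /build_cost /round_cost -mulnn; nia.
Qed.

End Rows.

Lemma exec_output I N E F P w :
  exec output (Store I N E F P (map Some w)) (2 * size w).+1
    (Store (I ++ map Some w) N E F P [::]).
Proof.
elim: w I => [|x w IH] I; first by rewrite /= cats0; apply: EForExit.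
apply: ELe.
  apply: (@EForStep _ _ _ _ x); [by [] | by case: x | exact: EPush | ].
  by have := IH (I ++ [:: Some x]); rewrite -!catA; apply.
by rewrite /=; lia.
Qed.

Definition kword (ks : seq kind) : seq (option bool) :=
  flatten [seq rcons [seq Some (kadj a b) | b <- ks] None | a <- ks].

Lemma krow_kword n rows :
  flatten [seq krow n rows a | a <- kinds n rows] = map Some (kword (kinds n rows)).
Proof.
rewrite /kword map_flatten -map_comp; congr flatten; apply: eq_map => a.
by rewrite /= map_rcons -map_comp.
Qed.

Lemma size_kword ks : size (kword ks) = size ks * (size ks).+1.
Proof.
suff gen s : size (flatten [seq rcons [seq Some (kadj a b) | b <- ks] None | a <- s]) =
    size s * (size ks).+1 by exact: gen.
elim: s => //= a s IH.
by rewrite size_cat IH size_rcons size_map mulSn.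
Qed.

(** * Delays and the theorem *)

Definition times (es : seq (option (seq bool))) : seq nat :=
  [seq i.+1 | i <- iota 0 (size es) & nth None es i].

Lemma times_delayed P f es :
  times (nseq P None ++ map (omap f) es) = map (addn P) (times es).
Proof.
rewrite /times size_cat size_nseq size_map iotaD filter_cat.
rewrite (_ : [seq i <- iota 0 P | _] = [::]) ?cat0s; last first.
  rewrite -(filter_pred0 (iota 0 P)); apply: eq_in_filter => i.
  by rewrite mem_iota /= => hi; rewrite nth_cat size_nseq hi nth_nseq hi.
rewrite add0n -[P in iota P]addn0 iotaDl filter_map -!map_comp.
rewrite (eq_map (g := addn P \o succn)); last by move=> i; rewrite /= addnS.
congr map; apply: eq_in_filter => i; rewrite mem_iota /= => hi.
rewrite nth_cat size_nseq ltnNge leq_addr addKn (nth_map None) //.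
by case: (nth None es i).
Qed.

(** A silent prefix of length [P] only postpones the first mark; later gaps stay the same. *)
Lemma delays_delayed P f b es : delays_bounded b es ->
  delays_bounded (P + b) (nseq P None ++ map (omap f) es).
Proof.
rewrite /delays_bounded /marks -!/(times _) times_delayed.
have -> : [:: size (nseq P None ++ map (omap f) es)] = map (addn P) [:: size es].
  by rewrite size_cat size_nseq size_map.
rewrite -map_cat; move: (times es ++ _) => t /=.
(* [x] and [x'] are the preceding marks without and with the prefix: both are 0 at first, and
   afterwards [x'] is [P + x]. Only [x <= x'] matters for the bound. *)
suff gen x x' : x <= x' -> all (fun p => p.2 - p.1 <= b) (zip (x :: t) t) ->
    all (fun p => p.2 - p.1 <= P + b) (zip (x' :: map (addn P) t) (map (addn P) t)).
  exact: gen.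
elim: t x x' => [|y t IH] x x' le_x //= /andP [le_y all_t].
by rewrite (IH y) ?leq_addl // andbT; lia.
Qed.

Definition hyp_word (n : nat) (rows : seq (seq bool)) : seq (option bool) :=
  nseq n (Some true) ++ None :: mat rows.

Lemma enc_hypE H : enc_hyp H =
  map plain_code (hyp_word (h_n H) [seq charvec E | E <- h_edges H]).
Proof.
rewrite /enc_hyp /hyp_word map_cat map_nseq -cats1 -catA; congr (_ ++ _).
rewrite /= /mat map_flatten -!map_comp; congr (_ :: flatten _); apply: eq_map => E /=.
by rewrite map_rcons -!map_comp.
Qed.

Lemma enc_kword n rows :
  enc_graph (split_of n rows) = map plain_code (kword (kinds n rows)).
Proof.
rewrite enc_split_of /kword map_flatten -map_comp; congr flatten; apply: eq_map => a /=.
by rewrite map_rcons -map_comp.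
Qed.

(** The exit is one past the last instruction, where [IHalt] starts the erasing phase. *)
Definition reduction : seq instr :=
  compile (build ;; output) 0 (len (build ;; output)).

Lemma size_reduction : size reduction = len (build ;; output).
Proof. exact: size_compile. Qed.

Lemma placed_reduction : placed reduction (build ;; output) 0 (size reduction).
Proof.
by split=> //; exists [::], [::]; rewrite cats0 size_reduction.
Qed.

(** * The preprocessing phase *)

Section Reduce.
Variables (M : TM) (n : nat) (rows : seq (seq bool)).
Let B := n + size (mat rows) + 1.
Let kw := kword (kinds n rows).

Lemma size_hyp_word : size (hyp_word n rows) = B.
Proof. by rewrite size_cat size_nseq /= addnS /B addn1. Qed.

(** There are at most [3 * B] vertices, as each row contributes a separator to the matrix, and
    [3 * B * (3 * B + 1)] is at most [12 * B ^ 2]. *)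
Lemma size_kw : size kw <= 12 * B ^ 2.
Proof.
rewrite size_kword size_kinds.
have : size rows <= size (mat rows) by rewrite -count_sep_mat count_size.
by rewrite /B -mulnn; nia.
Qed.

Hypothesis size_rows : all (fun r => size r == n) rows.

Lemma reduction_run :
  exists P c', [/\ P <= 200 * (200 * B ^ 4),
    silent P (tm_init (machine M reduction) (map plain_code (hyp_word n rows))) c' &
    simulates (tm_init M (map plain_code kw)) c'].
Proof.
pose st0 := Store (map Some (hyp_word n rows)) [::] [::] [::] [::] [::].
pose cells0 : seq (sym M) := [seq write M QI (Some y) | y <- hyp_word n rows].
have nc0 : nonblank cells0.
  by apply/allP => a /mapP [y _ ->]; apply: write_nonblank.
have hc0 : holds cells0 st0.
  move=> i; rewrite /cells0 (map_comp (write M QI) Some) content_QI.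
  by case: i.
have rc0 : ready 0 cells0 (tm_init (machine M reduction) (map plain_code (hyp_word n rows))).
  exists [::], [::]; split=> //; rewrite init_mk cats0; congr mk.
  by congr (inl (_, _)); apply: val_inj; rewrite /= inordK.
have [pl1 pl2] := placed_seq placed_reduction.
have [E ex1] := exec_build size_rows.
have st0E : st0 = Store (map bit (nseq n true) ++ sep :: map Some (mat rows))
    [::] [::] [::] [::] [::] by rewrite /st0 map_cat !map_nseq.
rewrite st0E in hc0; rewrite krow_kword -/kw in ex1.
have [t1 [c1 [cells1 [le1 sil1 rc1 [nc1 sz1] [hc1 _]]]]] := run_exec ex1 pl1 nc0 hc0 rc0.
have ex2 := exec_output [::] (circ (nseq n (Some true))) E [::] [::] kw.
have [t2 [c2 [cells2 [le2 sil2 rc2 [nc2 sz2] [hc2 td2]]]]] := run_exec ex2 pl2 nc1 hc1 rc1.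
(* [build] leaves [QI] empty, which is trivially tidy, and [output] preserves tidiness. *)
have td : tidy cells2 by apply: td2 => //; apply: tidy_empty; apply: (hc1 QI).
have [l [z [bl bz def_c2]]] := rc2.
have kw_nz : map Some kw <> [::].
  by move/(congr1 size); rewrite size_map size_kword size_kinds /=; nia.
have [t3 [l' [le3 bl' sil3]]] := run_erase reduction z td (hc2 QI) kw_nz bl.
have halt : tm_step c2 = Some (mk (inr None) l (cells2 ++ z) [::], None).
  have : cells2 <> [::] by move=> e; apply: kw_nz; rewrite -[LHS](hc2 QI) e.
  rewrite def_c2; case: (cells2) => // a w _; rewrite cat_cons step_mk /delta /goto.
  by rewrite inordK // nth_default.
exists (t1 + (t2 + t3.+1)); eexists; split.
- have szc : size cells0 = B by rewrite size_map size_hyp_word.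
  (* The summands are [80 * B ^ 2] for building, at most [24 * B ^ 2] for moving the word, and 1. *)
  have le_K : build_cost n rows + (2 * size kw).+1 <= 105 * B ^ 2.
    have := size_kw; have : 0 < B ^ 2 by rewrite expn_gt0 /B addn1.
    by rewrite /build_cost -/B; lia.
  have le_t2 := leq_trans le2 (sim_bound_mono sz1 (leqnn _)).
  have le_t12 := leq_trans (leq_add le1 le_t2) (sim_bound_add _ _ _).
  have := leq_trans le_t12 (sim_bound_mono (leqnn _) le_K).
  have le_B : B <= B ^ 2 by rewrite -mulnn leq_pmull // /B addn1.
  have : 0 < B by rewrite /B addn1.
  have -> : B ^ 4 = B ^ 2 * B ^ 2 by rewrite -expnD.
  rewrite szc in sz1 *; rewrite /sim_bound.
  move: (B ^ 2) (build_cost n rows) le_K le_B sz1 sz2 le3 => X K.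
  move=> le_K le_B sz1 sz2 le3; nia.
- exact: silent_trans sil1 (silent_trans sil2 (SilentS halt sil3)).
- exists l', ([seq write M QI x | x <- map Some kw] ++ z); split=> //= i.
    by rewrite nth_blanks // nth_nil.
  set w := map inord _.
  have -> : head ord0 w :: behead w = w by rewrite /w; case: (kw) kw_nz.
  have -> : [seq write M QI x | x <- map Some kw] = map (@inl _ _) w.
    by rewrite /w -!map_comp.
  rewrite nth_cat size_map; case: ltnP => hi; first by rewrite (nth_map ord0).
  by rewrite nth_blanks // nth_default.
Qed.
End Reduce.

Lemma delays_bounded_mono b b' es : b <= b' ->
  delays_bounded b es -> delays_bounded b' es.
Proof. by move=> le_b; apply: sub_all => p /leq_trans; apply. Qed.

Lemma leq_exp_poly B x e d : 0 < x <= B -> e <= d -> x ^ e <= B.+1 ^ d.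
Proof.
case/andP=> x_gt0 le_xB le_ed; apply: leq_trans (_ : x ^ d <= _).
  by rewrite leq_pexp2l.
by case: d {le_ed} => // d; rewrite leq_exp2r // ltnW.
Qed.

Theorem mainTheorem11 :
  (exists M : TM, poly_delay_enum M split_graph enc_graph cds_sol) ->
  exists M : TM, poly_delay_enum M hyp_valid enc_hyp mhs_sol.
Proof.
move=> [M [c [d enumM]]]; exists (machine M reduction).
(* Preprocessing takes at most [200 * 200 * B ^ 4] steps, and the delay of [M] on an input of length
   below [13 * B ^ 2] is at most [c * (13 * B ^ 2) ^ d]. *)
exists (200 * 200 + c * 13 ^ d), (4 + 2 * d) => H _.
set n := h_n H; set rows := [seq charvec E | E <- h_edges H].
have szr : all (fun r => size r == n) rows.
  by apply/allP => r /mapP [E _ ->]; rewrite size_charvec.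
have [k [halts delays uniq_outs outsP]] := enumM _ (split_of_split H).
have [P [c' [leP silP sim]]] := reduction_run M szr.
exists (P + k); rewrite enc_hypE (silent_run k silP) (simulates_run k sim).
rewrite -enc_kword -/n -/rows.
move: halts delays uniq_outs outsP; rewrite -/n -/rows.
set es := (tm_run k _).1 => halts delays uniq_outs outsP /=.
have outsE : pmap id (nseq P None ++ map (omap filter_out) es) =
    map filter_out (pmap id es).
  rewrite pmap_cat (_ : pmap id (nseq P None) = [::]) /=; last by elim: (P).
  by elim: es {halts delays uniq_outs outsP} => //= -[x|] es IH /=; rewrite IH.
have size_sol t : mhs_sol H t -> size t = n.
  by case=> T [_ ->]; rewrite size_charvec.
have solE s : s \in pmap id es -> exists2 t, mhs_sol H t & s = map (kmem t) (kinds n rows).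
  by move/outsP/cds_sol_split_of.
split=> //.
- rewrite size_map size_hyp_word; set B := n + _ + 1 in leP *.
  apply: delays_bounded_mono (delays_delayed P filter_out delays).
  have B_gt0 : 0 < B by rewrite /B addn1.
  have le_kw : (size (enc_graph (split_of n rows))).+1 <= 13 * B ^ 2.
    have := size_kw n rows; rewrite -/B enc_kword size_map.
    by have : 0 < B ^ 2 by [rewrite expn_gt0 B_gt0]; lia.
  rewrite mulnDl leq_add //.
    apply: leq_trans leP _; rewrite mulnA leq_mul2l /=.
    by apply: leq_exp_poly; rewrite ?B_gt0 ?leq_addr /=.
  rewrite -mulnA leq_mul2l; apply/orP; right.
  apply: leq_trans (_ : (13 * B ^ 2) ^ d <= _).
    by case: (d) => // d'; rewrite leq_exp2r.
  rewrite expnMn leq_mul2l -expnM; apply/orP; right.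
  by apply: leq_exp_poly; rewrite ?B_gt0 ?leq_addl /=.
(* On solutions the filter is injective: it returns [t], which determines the whole solution. *)
- rewrite outsE map_inj_in_uniq // => s1 s2 /solE [t1 sol1 ->] /solE [t2 sol2 ->].
  by rewrite !filter_out_kinds ?size_sol // => ->.
- move=> t; rewrite outsE; split=> [/mapP [s /solE [t' sol' ->] ->]|sol].
    by rewrite filter_out_kinds ?size_sol.
  apply/mapP; exists (map (kmem t) (kinds n rows)).
    by apply/outsP/cds_sol_split_of; exists t.
  by rewrite filter_out_kinds ?size_sol.
Qed.
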